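(* Let $\Omega\subset\mathbb{R}^d$ be compact and let $V=\{V_j(\Omega)\}_{j\in\mathbb{N}}$ be a multiresolution analysis with properties MRA1), MRA2), MRA3) and associated biorthogonal wavelet bases satisfying W1)-W4), all listed in the context. Assume that $\frac{3d}{2}<s$. Let $J\ge0$ and suppose that the iterative integration formula $\mathbf{INTEGRATE}$ is executed (at level $J$) on a $\Delta_J$-dense set $X_J$, with associated partition $\Psi_J$, for $\Delta_J>0$ large enough, so that for some $0<\eta<1$ $$\|(I-P_JQ_{\Psi_J,X_J})g\|_\infty\le\eta\|g\|_\infty\quad\text{for all }g\in V_J(\Omega).$$ Then there exists a constant $C>0$ such that, for all $f\in H^s(\Omega)$, with $\mathbf{f}^s$ the vector of samples of $f$ on $X_J$, $$\left|\mathbf{INTEGRATE}[\infty,\mathbf{f}^s]-\int_\Omega f(x)\,dx\right|\le C\,\frac{|\Omega|\,\|P_J\|}{1-\eta}\,\|f\|_{H^s(\Omega)}\,\frac{2^{(\frac{3d}{2}-s)(J+1)}}{1-2^{\frac{3d}{2}-s}} .$$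
   Context: Setting. $\Omega\subset\mathbb{R}^d$ is compact, $|\Omega|$ is its Lebesgue measure, $\chi_\Omega$ is the constant function $1$ on $\Omega$, $B_\delta(x)$ is the ball of center $x$ and radius $\delta$, $\langle f,g\rangle=\int_\Omega f\overline{g}\,dx$, and $H^s(\Omega)$ is the $L^2$-Sobolev space of order $s$ ($H^0=L^2$). Since $s>d/2$, the Sobolev embedding theorem gives $H^s(\Omega)\subset C(\Omega)$, and point samples are those of the continuous representative. $C^1(\Omega,\mathbb{R}_+)$ denotes the nonnegative continuously differentiable functions on $\Omega$ (restrictions to $\Omega$ of functions that are $C^1$ in a neighbourhood of $\Omega$). $\|P_J\|$ is the operator norm of $P_J$ with respect to the sup-norm. MRA1) $V=\{V_j(\Omega)\}_{j\in\mathbb{N}}$ are finite dimensional spaces such that for all $q\in(1,\infty)$: $\chi_\Omega\in V_0(\Omega)\subset V_1(\Omega)\subset\dots\subset V_j(\Omega)\subset\dots\subset L^q(\Omega)$ and $\bigcup_jV_j(\Omega)$ is dense in $L^q(\Omega)$. MRA2) Each $V_j(\Omega)$ has a basis $\Phi_j=\{\phi_{j,0},\dots,\phi_{j,N_j}\}\subset C^1(\Omega,\mathbb{R}_+)$ such that $\Phi_{j-1}=A_j\Phi_j$ for a suitable (stochastic) real scaling matrix $A_j$ of size $(N_{j-1}+1)\times(N_j+1)$, and $2^{-dj/2}\sum_{k=0}^{N_j}\phi_{j,k}\equiv1$ for all $j$. Moreover there are $C>0$ and $m\in\mathbb{N}$, independent of $j$ and $k$, such that $\operatorname{diam}(\operatorname{supp}\phi_{j,k})\le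 C2^{-j}$, $\#\{k:\operatorname{supp}(\phi_{j,k})\cap\operatorname{supp}(\phi_{j,k'})\ne\emptyset\}\le m$ for all $k'$, and $\|\nabla\phi_{j,k}\|_\infty\le C2^{j(d/2+1)}$. MRA3) For each $j$, $P_j:L^2(\Omega)\to V_j(\Omega)$ is a linear projector ($P_jf=f$ for all $f\in V_j(\Omega)$), bounded with respect to the sup-norm on bounded functions, and $f=\lim_{j\to\infty}P_jf$ in $L^2(\Omega)$ for all $f\in L^2(\Omega)$. It has the form $P_jf=\sum_{k=0}^{N_j}\langle f,\tilde\phi_{j,k}\rangle\phi_{j,k}$ with $\{\tilde\phi_{j,k}\}_{k=0}^{N_j}\subset L^2(\Omega)$, $\langle\phi_{j,h},\tilde\phi_{j,k}\rangle=\delta_{h,k}$. W1) There is a biorthogonal wavelet basis $\{\Psi_{j,k}\}_{j\ge0,k\in\mathcal{J}_j}$, $\Psi_{j,k}\in V_{j+1}(\Omega)$, with dual system $\{\tilde\Psi_{j,k}\}\subset L^2(\Omega)$, associated to the multiresolution analysis (so $\langle\Psi_{j,k},\tilde\Psi_{j',k'}\rangle=\delta_{j,j'}\delta_{k,k'}$, and $\langle\Psi_{j,k},\tilde\phi_{J,k'}\rangle=0=\langle\phi_{J,k'},\tilde\Psi_{j,k}\rangle$ for $j\ge J$), such that for every $J\ge0$ every $f\in L^2(\Omega)$ can be written $f=\sum_{k=0}^{N_J}\langle f,\tilde\phi_{J,k}\rangle\phi_{J,k}+\sum_{j\ge J,k\in\mathcal{J}_j}\langle f,\tilde\Psi_{j,k}\rangle\Psi_{j,k}=P_J(f)+f_J^\perp$.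 W2) $f\in H^s(\Omega)$, $s\ge0$, if and only if $c_1\|f\|_{H^s(\Omega)}\le\|P_Jf\|_2+\big(\sum_{j\ge J,k\in\mathcal{J}_j}2^{2sj}|\langle f,\tilde\Psi_{j,k}\rangle|^2\big)^{1/2}\le c_2\|f\|_{H^s(\Omega)}$ with $c_1,c_2>0$ independent of $f$ (that is, the middle quantity is finite exactly for $f\in H^s(\Omega)$ and is then equivalent to the $H^s$ norm). W3) $\|\Psi_{j,k}\|_\infty\le C_\Psi2^{dj/2}$ and $\#\mathcal{J}_j\le C_{\mathcal{J}}2^{dj}$. W4) $\int_\Omega\Psi_{j,k}(x)\,dx=0$ for all $j\ge0$, $k\in\mathcal{J}_j$. Sampling sets. A finite set $X=\{x_\ell\}_{\ell=0}^M\subset\Omega$ is called $\Delta$-dense ($\Delta>0$) if, with $\delta=\Delta^{-1}$, $\Omega=\big(\bigcup_{\ell=0}^MB_\delta(x_\ell)\big)\cap\Omega$. A partition associated to a $\Delta$-dense set $X$ is a set $\Psi=\{\psi_\ell\}_{\ell=0}^M\subset L^\infty(\Omega)$ with $0\le\psi_\ell\le1$, $\operatorname{supp}(\psi_\ell)\subset B_\delta(x_\ell)$ and $\sum_{\ell=0}^M\psi_\ell\equiv1$ on $\Omega$. The quasi-interpolation operator is $Q_{\Psi,X}f=\sum_{\ell=0}^Mf(x_\ell)\psi_\ell$ for $f\in C(\Omega)$. Procedure $\mathbf{INTEGRATE}$ at level $j$. Given $X_j=\{x_{j,\ell}\}_{\ell=0}^{M_j}$ and $\Psi_j=\{\psi_{j,\ell}\}_{\ell=0}^{M_j}$,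 put $\mathbf{M}=(\langle\psi_{j,\ell},\tilde\phi_{j,k}\rangle)_{k=0,\dots,N_j;\,\ell=0,\dots,M_j}$, $\mathbf{\Phi}^s=(\phi_{j,k}(x_{j,\ell}))_{\ell=0,\dots,M_j;\,k=0,\dots,N_j}$, $\mathbf{PQ}_s=\mathbf{\Phi}^s\mathbf{M}$ and $\omega_j=[\int_\Omega\phi_{j,0}\,dx,\dots,\int_\Omega\phi_{j,N_j}\,dx]^T$. For $\mathbf{v}\in\mathbb{C}^{M_j+1}$ define $$I^{(0)}=\omega_j^T\mathbf{M}\mathbf{v},\quad \mathbf{u}^{(0)}=\mathbf{PQ}_s\mathbf{v},\qquad I^{(i+1)}=I^{(i)}+\omega_j^T\mathbf{M}(\mathbf{v}-\mathbf{u}^{(i)}),\quad \mathbf{u}^{(i+1)}=\mathbf{u}^{(i)}+\mathbf{PQ}_s(\mathbf{v}-\mathbf{u}^{(i)})\quad(i\ge0),$$ $\mathbf{INTEGRATE}[n,\mathbf{v}]=I^{(n+1)}$ and $\mathbf{INTEGRATE}[\infty,\mathbf{v}]=\lim_{n\to\infty}\mathbf{INTEGRATE}[n,\mathbf{v}]$. For $f\in C(\Omega)$, $\mathbf{f}^s=[f(x_{j,0}),\dots,f(x_{j,M_j})]^T$. *)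

(* Defs.v *)
From HB Require Import structures.
From mathcomp Require Import all_boot all_order all_algebra.
From mathcomp Require Import all_classical all_reals all_analysis.
From mathcomp Require Import complex.
Set Implicit Arguments. Unset Strict Implicit. Unset Printing Implicit Defensive.
Import Order.TTheory GRing.Theory Num.Theory.
Import numFieldNormedType.Exports.
Local Open Scope classical_set_scope.
Local Open Scope complex_scope.
Local Open Scope ring_scope.

(* The Borel sigma-algebra of R^n, generated by the coordinate projections. *)
Section rV_measurable.
Context {R : realType} {n : nat}.

Let coors : 'I_n -> 'rV[R]_n -> measurableTypeR R := fun i x => x ord0 i.

Let rV_set0 : g_sigma_preimage coors set0.
Proof. exact: sigma_algebra0. Qed.
Let rV_setC A : g_sigma_preimage coors A -> g_sigma_preimage coors (~` A).
Proof. exact: sigma_algebraC. Qed.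
Let rV_bigcup (F : (set 'rV[R]_n)^nat) : (forall i, g_sigma_preimage coors (F i)) ->
  g_sigma_preimage coors (\bigcup_i (F i)).
Proof. exact: sigma_algebra_bigcup. Qed.

HB.instance Definition _ := @isMeasurable.Build (measure_tuple_display R.-ocitv)
  'rV[R]_n (g_sigma_preimage coors) rV_set0 rV_setC rV_bigcup.
End rV_measurable.

Section leb_step.
Context {R : realType} {n : nat}.

Lemma measurable_rVP d (T : measurableType d) m (f : T -> 'rV[R]_m) :
  (forall i, measurable_fun setT (fun x => f x ord0 i : measurableTypeR R)) ->
  measurable_fun setT f.
Proof.
move=> mf; apply: (@measurability _ _ T 'rV[R]_m setT f _ erefl).
move=> _ [A +] <-; rewrite -bigcup_seq => -[i /= _ [B mB <-]].
rewrite !setTI -comp_preimage -[X in measurable X]setTI; exact: mf.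
Qed.

Lemma measurable_coord m (i : 'I_m) :
  measurable_fun setT (fun x : 'rV[R]_m => x ord0 i : measurableTypeR R).
Proof.
move=> _ Y mY; rewrite setTI; apply: sub_sigma_algebra => /=.
rewrite -bigcup_seq/=; exists i => /=; first by rewrite mem_index_enum.
by exists Y => //; rewrite setTI.
Qed.

Definition rV_cons (p : measurableTypeR R * 'rV[R]_n) : 'rV[R]_n.+1 :=
  row_mx (p.1)%:M p.2 : 'rV_(1 + n).
Definition rV_uncons (x : 'rV[R]_n.+1) : measurableTypeR R * 'rV[R]_n :=
  (x ord0 ord0, \row_i x ord0 (lift ord0 i)).

Lemma rV_consK : cancel rV_cons rV_uncons.
Proof.
case=> a v; rewrite /rV_uncons /rV_cons /=; congr pair.
  by rewrite mxE; case: splitP => // j _; rewrite mxE !ord1.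
apply/rowP => i; rewrite !mxE; case: splitP => j; first by rewrite ord1.
by move=> /= /eqP; rewrite eqSS => /eqP ij; congr (v _ _); exact: val_inj.
Qed.

Lemma rV_unconsK : cancel rV_uncons rV_cons.
Proof.
move=> x; apply/rowP => i; rewrite /rV_cons /rV_uncons /=.
rewrite mxE; case: splitP => j ij; rewrite mxE.
  rewrite !ord1 eqxx mulr1n; congr (x _ _); apply: val_inj.
  by rewrite /= ij ord1.
by congr (x _ _); apply: val_inj; rewrite /= ij.
Qed.

Lemma measurable_rV_cons : measurable_fun setT rV_cons.
Proof.
apply: measurable_rVP => i.
have -> : (fun x => rV_cons x ord0 i : measurableTypeR R) =
  match fintype.split (i : 'I_(1 + n)) with
  | inl _ => fst | inr k => (fun v : 'rV[R]_n => v ord0 k) \o snd end.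
  apply/funext => -[a v]; rewrite /rV_cons /= mxE; case: fintype.split => k //=.
  by rewrite !ord1 mxE.
case: fintype.split => k; first exact: measurable_fst.
by apply: measurableT_comp; [exact: measurable_coord|exact: measurable_snd].
Qed.

Lemma measurable_rV_uncons : measurable_fun setT rV_uncons.
Proof.
apply/measurable_fun_pairP; split; first exact: measurable_coord.
apply: measurable_rVP => i; rewrite /=.
under eq_fun do rewrite mxE.
exact: measurable_coord.
Qed.


Variable mu : {sigma_finite_measure set 'rV[R]_n -> \bar R}.

Let nu : {measure set (measurableTypeR R * 'rV[R]_n)%type -> \bar R} :=
  (@lebesgue_measure R \x mu)%E.

Let nu_sigma_finite : sigma_finite setT nu.
Proof.
have /sigma_finiteP[F [TF ndF Foo]] := sigma_finiteT (@lebesgue_measure R).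
have /sigma_finiteP[G [TG ndG Goo]] := sigma_finiteT mu.
exists (fun k => F k `*` G k).
  rewrite -setXTT TF TG predeqE => -[x y]; split.
    move=> [/= [k _ Fkx] [l _ Gly]]; exists (maxn k l) => //; split.
    - by move: x Fkx; exact/subsetPset/ndF/leq_maxl.
    - by move: y Gly; exact/subsetPset/ndG/leq_maxr.
  by move=> [k _ []/= ? ?]; split; exists k.
move=> k; have [? ?] := Foo k; have [? ?] := Goo k.
split; first exact: measurableX.
rewrite [ltLHS](_ : _ = lebesgue_measure (F k) * mu (G k))%E; last first.
  exact: product_measure1E.
by rewrite lte_mul_pinfty// ge0_fin_numE.
Qed.

Definition leb_step : set 'rV[R]_n.+1 -> \bar R := pushforward nu rV_cons.

Let leb_step0 : leb_step set0 = 0%E.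
Proof. by rewrite /leb_step /pushforward preimage_set0 measure0. Qed.

Let leb_step_ge0 A : (0 <= leb_step A)%E.
Proof. by rewrite /leb_step /pushforward measure_ge0. Qed.

Let measurable_preimage A : measurable A -> measurable (rV_cons @^-1` A).
Proof.
by move=> mA; rewrite -[X in measurable X]setTI; exact: measurable_rV_cons.
Qed.

Let leb_step_sigma_additive : semi_sigma_additive leb_step.
Proof.
move=> F mF tF mUF; rewrite /leb_step /pushforward preimage_bigcup.
apply: measure_semi_sigma_additive.
- by move=> k; exact: measurable_preimage.
- apply/trivIsetP => /= i j _ _ ij; rewrite -preimage_setI.
  by move/trivIsetP : tF => /(_ _ _ _ _ ij) ->//; rewrite preimage_set0.
- by rewrite -preimage_bigcup; exact: measurable_preimage.
Qed.

HB.instance Definition _ := isMeasure.Build _ _ _ leb_step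
  leb_step0 leb_step_ge0 leb_step_sigma_additive.

Let leb_step_sigma_finite : sigma_finite setT leb_step.
Proof.
have [F FT Ffin] := nu_sigma_finite.
exists (fun k => rV_uncons @^-1` F k).
  by rewrite -preimage_bigcup -FT preimage_setT.
move=> k; have [mF Foo] := Ffin k; split.
  by rewrite -[X in measurable X]setTI; exact: measurable_rV_uncons.
rewrite /leb_step /pushforward -comp_preimage.
by rewrite (_ : rV_uncons \o rV_cons = id) //; apply/funext/rV_consK.
Qed.

HB.instance Definition _ := Measure_isSigmaFinite.Build _ _ _ leb_step
  leb_step_sigma_finite.

End leb_step.

(* Lebesgue measure on R^n as the n-fold product of the one on R. *)
Fixpoint leb (R : realType) (n : nat) :
    {sigma_finite_measure set 'rV[R]_n -> \bar R} :=
  match n with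
  | 0 => \d_(0 : 'rV[R]_0)
  | n'.+1 => leb_step (leb R n')
  end.

Section functions_on_Omega.
Context {R : realType} {d : nat}.
Local Notation E := 'rV[R]_d.
Local Notation C := R[i].
Implicit Types (Omega : set E) (f g : E -> C).

Definition enorm (x : E) : R := Num.sqrt (\sum_i x ord0 i ^+ 2).
Definition edot (x y : E) : R := \sum_i x ord0 i * y ord0 i.
Definition eball (x : E) (r : R) : set E := [set y | enorm (y - x) < r].

(* Functions on Omega are total functions on R^d of which only the values on
   Omega matter. *)
Definition cmeasurable Omega f :=
  measurable_fun Omega (fun x => complex.Re (f x)) /\
  measurable_fun Omega (fun x => complex.Im (f x)).

Definition ccontinuous Omega f :=
  {within Omega, continuous (fun x => complex.Re (f x))} /\
  {within Omega, continuous (fun x => complex.Im (f x))}.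

Definition cint Omega f : C :=
  (\int[leb R d]_(x in Omega) complex.Re (f x)) +i*
  (\int[leb R d]_(x in Omega) complex.Im (f x)).

Definition inner Omega f g : C := cint Omega (fun x => f x * conjc (g x)).

Definition Lqnorm Omega (q : R) f : \bar R :=
  Lnorm (leb R d) q%:E (fun x => (Normc.normc (f x) * \1_Omega x)%:E).

Definition inLq Omega (q : R) f :=
  cmeasurable Omega f /\ (Lqnorm Omega q f < +oo)%E.

Definition supnorm Omega f : \bar R :=
  ereal_sup [set (Normc.normc (f x))%:E | x in Omega].

Definition supp Omega (g : E -> R) : set E :=
  closure (Omega `&` [set x | g x != 0]).

Definition partial (i : 'I_d) (g : E -> R) : E -> R :=
  fun x => 'D_(delta_mx ord0 i) g x.

(* The total function g is itself a C^1 extension of its restriction to Omega,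
   so that its gradient makes sense at every point of Omega. *)
Definition C1_near Omega (g : E -> R) :=
  exists U : set E, [/\ open U, Omega `<=` U,
    forall x, U x -> differentiable g x &
    forall i x, U x -> {for x, continuous (partial i g)}].

Definition grad_norm (g : E -> R) (x : E) : R :=
  Num.sqrt (\sum_i partial i g x ^+ 2).

End functions_on_Omega.

Section sobolev.
Context {R : realType} {d : nat}.
Local Notation E := 'rV[R]_d.
Local Notation C := R[i].

Definition fourier_trunc (n : nat) (F : E -> C) (xi : E) : C :=
  ((2 * pi) `^ (- (d%:R / 2)))%:C *
  cint [set x | enorm x <= n%:R]
    (fun x => F x * (cos (edot x xi) -i* sin (edot x xi))).

(* G is the unitary Fourier-Plancherel transform of F in L^2(R^d), that is, the
   L^2-limit of the Fourier integrals over growing balls. *)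
Definition is_fourier (F G : E -> C) :=
  [/\ inLq setT 2 F, inLq setT 2 G &
    (fun n => Lqnorm setT 2 (fun xi => G xi - fourier_trunc n F xi)) @ \oo
      --> 0%E].

(* H^s(Omega) is the space of restrictions to Omega of the elements of
   H^s(R^d) (Bessel potential spaces), with the quotient norm; the infimum of
   the empty set is +oo. *)
Definition sobolev_norm (Omega : set E) (s : R) (f : E -> C) : \bar R :=
  ereal_inf [set r | exists F G : E -> C,
    [/\ is_fourier F G,
        {ae leb R d, forall x, Omega x -> F x = f x} &
        r = Lqnorm setT 2
              (fun xi => ((1 + enorm xi ^+ 2) `^ (s / 2))%:C * G xi)]].

Definition in_sobolev (Omega : set E) (s : R) (f : E -> C) :=
  inLq Omega 2 f /\ (sobolev_norm Omega s f < +oo)%E.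

Definition continuous_representative (Omega : set E) (f fc : E -> C) :=
  ccontinuous Omega fc /\ {ae leb R d, forall x, Omega x -> fc x = f x}.

End sobolev.

Record mra_data (R : realType) (d : nat) := MraData {
  mra_space : nat -> set ('rV[R]_d -> R[i]);
  mra_N : nat -> nat;
  mra_phi : forall j, 'I_(mra_N j).+1 -> 'rV[R]_d -> R;
  mra_dual : forall j, 'I_(mra_N j).+1 -> 'rV[R]_d -> R[i] }.

Record wavelet_data (R : realType) (d : nat) := WaveletData {
  wav_idx : nat -> finType;
  wav_psi : forall j, wav_idx j -> 'rV[R]_d -> R[i];
  wav_dual : forall j, wav_idx j -> 'rV[R]_d -> R[i] }.

Section multiresolution.
Context {R : realType} {d : nat}.
Local Notation E := 'rV[R]_d.
Local Notation C := R[i].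
Variables (Omega : set E) (V : mra_data R d) (W : wavelet_data R d).

Local Notation Vj := (mra_space V).
Local Notation N := (mra_N V).
Local Notation phi := (mra_phi (m := V)).
Local Notation phit := (mra_dual (m := V)).
Local Notation Psi := (wav_psi (w := W)).
Local Notation Psit := (wav_dual (w := W)).

Definition mra_proj (j : nat) (f : E -> C) : E -> C := fun x =>
  \sum_(k < (N j).+1) inner Omega f (phit k) * (phi k x)%:C.

(* Operator norm of P_j for the sup-norm on bounded functions. *)
Definition mra_proj_norm (j : nat) : \bar R :=
  ereal_sup [set supnorm Omega (mra_proj j f) | f in
    [set f | cmeasurable Omega f /\ (supnorm Omega f <= 1)%E]].

Definition is_basis (S : set (E -> C)) (n : nat) (b : 'I_n -> E -> R) :=
  (forall f, S f <-> exists c : 'I_n -> C,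
     forall x, Omega x -> f x = \sum_k c k * (b k x)%:C) /\
  (forall c : 'I_n -> C,
     (forall x, Omega x -> \sum_k c k * (b k x)%:C = 0) -> forall k, c k = 0).

Definition MRA1 :=
  [/\ Vj 0%N (fun=> 1),
      forall j, Vj j `<=` Vj j.+1,
      forall q : R, 1 < q -> forall j, Vj j `<=` inLq Omega q &
      forall q : R, 1 < q -> forall f, inLq Omega q f ->
        forall e : R, 0 < e -> exists j g, Vj j g /\
          (Lqnorm Omega q (fun x => f x - g x)%R < e%:E)%E].

(* In the normalisation of phi, with 2^(-dj/2) sum_k phi_(j,k) = 1, it is the
   matrix 2^(d/2) A_j that is (column-)stochastic: it relates the partitions of
   unity (2^(-dj/2) phi_(j,k))_k of two consecutive levels. *)
Definition scaling_matrix (j : nat)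
    (A : 'M[R]_((N j).+1, (N j.+1).+1)) :=
  [/\ forall k h, 0 <= A k h,
      forall h, \sum_k 2 `^ (d%:R / 2) * A k h = 1 &
      forall k x, Omega x -> phi k x = \sum_h A k h * phi h x].

Definition MRA2 :=
  [/\ forall j, is_basis (Vj j) (phi (j := j)),
      forall j (k : 'I_(N j).+1),
        C1_near Omega (phi k) /\ forall x, Omega x -> 0 <= phi k x,
      forall j, exists A, @scaling_matrix j A,
      forall j x, Omega x ->
        2 `^ (- (d%:R * j%:R / 2)) * \sum_(k < (N j).+1) phi k x = 1 &
      exists (c : R) (m : nat), 0 < c /\ forall j (k : 'I_(N j).+1),
        [/\ forall x y, supp Omega (phi k) x -> supp Omega (phi k) y ->
              enorm (x - y) <= c * 2 `^ (- j%:R),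
            (#|[set k' : 'I_(N j).+1 |
                `[< supp Omega (phi k') `&` supp Omega (phi k) !=set0 >]]%SET|
               <= m)%N &
            forall x, Omega x ->
              grad_norm (phi k) x <= c * 2 `^ (j%:R * (d%:R / 2 + 1))]].

Definition MRA3 :=
  [/\ forall j (k : 'I_(N j).+1), inLq Omega 2 (phit k),
      forall j (h k : 'I_(N j).+1),
        inner Omega (fun x => (phi h x)%:C) (phit k) = (h == k)%:R,
      forall j f, Vj j f -> forall x, Omega x -> mra_proj j f x = f x,
      forall j, (mra_proj_norm j < +oo)%E &
      forall f, inLq Omega 2 f ->
        (fun j => Lqnorm Omega 2 (fun x => f x - mra_proj j f x)) @ \oo
          --> 0%E].

Definition W1 :=
  [/\ forall j (k : wav_idx W j), Vj j.+1 (Psi k) /\ inLq Omega 2 (Psit k),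
      forall j j' (k : wav_idx W j) (k' : wav_idx W j'),
        inner Omega (Psi k) (Psit k') =
          (Tagged (wav_idx W) k == Tagged (wav_idx W) k')%:R,
      forall J j (k : wav_idx W j) (k' : 'I_(N J).+1), (J <= j)%N ->
        inner Omega (Psi k) (phit k') = 0 /\
        inner Omega (fun x => (phi k' x)%:C) (Psit k) = 0 &
      forall J f, inLq Omega 2 f ->
        (fun n => Lqnorm Omega 2 (fun x => f x - (mra_proj J f x +
            \sum_(J <= j < n) \sum_(k : wav_idx W j)
              inner Omega f (Psit k) * Psi k x))) @ \oo --> 0%E].

Definition wavelet_norm (s : R) (J : nat) (f : E -> C) : \bar R :=
  (Lqnorm Omega 2 (mra_proj J f) +
   (\sum_(J <= j <oo) (\sum_(k : wav_idx W j) 2 `^ (2 * s * j%:R) *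
      Normc.normc (inner Omega f (Psit k)) ^+ 2)%R%:E) `^ (2^-1)%R)%E.

Definition W2 (s : R) :=
  forall J, exists c1 c2 : R, [/\ 0 < c1, 0 < c2 &
    forall f, inLq Omega 2 f ->
      (in_sobolev Omega s f <-> (wavelet_norm s J f < +oo)%E) /\
      (in_sobolev Omega s f ->
        (c1%:E * sobolev_norm Omega s f <= wavelet_norm s J f)%E /\
        (wavelet_norm s J f <= c2%:E * sobolev_norm Omega s f)%E)].

Definition W3 :=
  exists cPsi cJ : R, [/\ 0 < cPsi, 0 < cJ,
    forall j (k : wav_idx W j),
      (supnorm Omega (Psi k) <= (cPsi * 2 `^ (d%:R * j%:R / 2))%:E)%E &
    forall j, (#|wav_idx W j|%:R : R) <= cJ * 2 `^ (d%:R * j%:R)].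

Definition W4 := forall j (k : wav_idx W j), cint Omega (Psi k) = 0.

End multiresolution.

Section sampling.
Context {R : realType} {d : nat}.
Local Notation E := 'rV[R]_d.
Local Notation C := R[i].
Variables (Omega : set E) (V : mra_data R d).

Definition dense_sample (Delta : R) (M : nat) (X : 'I_M.+1 -> E) :=
  [/\ 0 < Delta, forall l, Omega (X l) &
      Omega = (\bigcup_l eball (X l) Delta^-1) `&` Omega].

Definition sample_partition (Delta : R) (M : nat) (X : 'I_M.+1 -> E)
    (psi : 'I_M.+1 -> E -> R) :=
  [/\ forall l, measurable_fun Omega (psi l),
      forall l x, Omega x -> 0 <= psi l x <= 1,
      forall l, supp Omega (psi l) `<=` eball (X l) Delta^-1 &
      forall x, Omega x -> \sum_l psi l x = 1].

Definition quasi_interp (M : nat) (X : 'I_M.+1 -> E)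
    (psi : 'I_M.+1 -> E -> R) (f : E -> C) : E -> C :=
  fun x => \sum_l f (X l) * (psi l x)%:C.

Definition samples (M : nat) (X : 'I_M.+1 -> E) (f : E -> C) : 'cV[C]_M.+1 :=
  \col_l f (X l).

Section integrate.
Variables (j M : nat) (X : 'I_M.+1 -> E) (psi : 'I_M.+1 -> E -> R).
Local Notation N := (mra_N V j).

Definition mxM : 'M[C]_(N.+1, M.+1) :=
  \matrix_(k, l) inner Omega (fun x => (psi l x)%:C) (mra_dual k).
Definition mxPhi : 'M[C]_(M.+1, N.+1) := \matrix_(l, k) (mra_phi k (X l))%:C.
Definition mxPQ : 'M[C]_M.+1 := mxPhi *m mxM.
Definition omega : 'cV[C]_N.+1 :=
  \col_k cint Omega (fun x => (mra_phi k x)%:C).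

Definition integrate_init (v : 'cV[C]_M.+1) : C * 'cV[C]_M.+1 :=
  ((omega^T *m mxM *m v) ord0 ord0, mxPQ *m v).

Definition integrate_step (v : 'cV[C]_M.+1) (p : C * 'cV[C]_M.+1) :
    C * 'cV[C]_M.+1 :=
  (p.1 + (omega^T *m mxM *m (v - p.2)) ord0 ord0, p.2 + mxPQ *m (v - p.2)).

(* The pair (I^(i), u^(i)) is [iter i (integrate_step v) (integrate_init v)]. *)
Definition integrate (n : nat) (v : 'cV[C]_M.+1) : C :=
  (iter n.+1 (integrate_step v) (integrate_init v)).1.

Definition integrate_converges (v : 'cV[C]_M.+1) :=
  cvgn (fun n => complex.Re (integrate n v)) /\
  cvgn (fun n => complex.Im (integrate n v)).

Definition integrate_oo (v : 'cV[C]_M.+1) : C :=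
  limn (fun n => complex.Re (integrate n v)) +i*
  limn (fun n => complex.Im (integrate n v)).

End integrate.
End sampling.

(* Main.v *)
(* Put T = P_J Q on V_J. Since ||I - T|| <= eta < 1 for the sup-norm, the
   coefficient iteration behind INTEGRATE converges geometrically to the
   coefficients of g in V_J with T g = P_J Q f, and INTEGRATE[oo] is the integral
   of g. Moreover T (g - P_J f) = P_J Q (f - P_J f), hence
   ||g - P_J f|| <= ||P_J|| ||f - P_J f|| / (1 - eta), while f and P_J f have the
   same integral because the wavelets have mean zero. Finally W2 bounds each
   coefficient by |<f, Psit_(j,k)>| <= c 2^(-s j) ||f||_(H^s), and W3 turns this
   into a geometric series of ratio 2^(3 d / 2 - s) for ||f - P_J f||. *)

Require Import Defs.
From HB Require Import structures.
From mathcomp Require Import all_boot all_order all_algebra.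
From mathcomp Require Import all_classical all_reals all_analysis.
From mathcomp Require Import measurable_realfun finmap complex ring lra.
Set Implicit Arguments.
Unset Strict Implicit.
Unset Printing Implicit Defensive.
Import Order.TTheory GRing.Theory Num.Theory.
Import numFieldNormedType.Exports.
Local Open Scope classical_set_scope.
Local Open Scope complex_scope.
Local Open Scope ring_scope.

(** Two obstacles shape the proof. First, INTEGRATE sees the values of [fc] at single points, while
    the wavelet expansion converges only in L^2. Its partial sums are bounded uniformly in their
    length, so the bound for f - P_J f survives almost everywhere; it reaches the sample points
    because Omega has positive measure near each of its points. This is not assumed of Omega: it
    follows from the shrinking supports and the biorthogonality of the scaling functions. Second,
    the contraction is known on V_J and not on vectors of samples. The iteration is therefore lifted
    to coefficient vectors, where T becomes the square matrix [mxM *m mxPhi]; its invertibility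
    comes from the same estimate that bounds the error. The constant is fixed before the level and
    the sampling set are chosen. *)

(** * Compact sets are measurable and have finite Lebesgue measure *)

Section geometry.
Context {R : realType} {n : nat}.
Implicit Types (K : set 'rV[R]_n) (x y : 'rV[R]_n).

Lemma measurable_rV_pi (B : 'I_n -> set (measurableTypeR R)) :
  (forall i, measurable (B i)) ->
  measurable [set x : 'rV[R]_n | forall i, B i (x ord0 i)].
Proof.
move=> mB.
have -> : [set x : 'rV[R]_n | forall i, B i (x ord0 i)] =
    \bigcap_(i in [set: 'I_n]) ((fun x : 'rV[R]_n => x ord0 i) @^-1` B i).
  by apply/seteqP; split => x /= h i; [move=> _; exact: h|exact: (h i I)].
apply: fin_bigcap_measurable => // i _.
rewrite -[X in measurable X]setTI; exact: measurable_coord.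
Qed.

Lemma measurable_rV_ball x (e : R) : measurable (ball x e).
Proof.
have [e0|e0] := ltP 0 e; last first.
  suff -> : ball x e = set0 by exact: measurable0.
  by apply/seteqP; split => // y [+ _]; rewrite ltNge e0.
have -> : ball x e = [set y : 'rV[R]_n | forall i, ball (x ord0 i) e (y ord0 i)].
  apply/seteqP; split => y /=; first by case=> _ h i; exact: h.
  by move=> h; split => // i j; rewrite ord1; exact: h.
apply: (@measurable_rV_pi (fun i => ball (x ord0 i) e)) => i.
exact: measurable_ball.
Qed.

Lemma measurable_rV_box (r : R) :
  measurable [set x : 'rV[R]_n | forall i, - r <= x ord0 i <= r].
Proof.
exact: (measurable_rV_pi (fun=> measurable_itv `[- r, r])).
Qed.

(** The sigma-algebra is generated by coordinates, so closed sets are not measurable by definition.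
    Balls of the sup-norm are boxes, hence measurable, and a compact set is the intersection over k
    of finite unions of balls of radius 1/(k+1) centred in it; closedness gives the inclusion of
    this intersection in K. *)
Lemma compact_rV_measurable K : compact K -> measurable K.
Proof.
move=> cK.
have cover k : exists D : {fset 'rV[R]_n},
    [set` D] `<=` K /\ K `<=` \bigcup_(x in [set` D]) ball x k.+1%:R^-1.
  move: (cK); rewrite compact_cover.
  move=> /(_ _ K (fun x => ball x k.+1%:R^-1)) [].
  - by move=> x _; exact: ball_open.
  - by move=> x Kx; exists x => //; exact: ballxx.
  move=> D DK KD; exists D; split => // x xD.
  exact: set_mem (DK x xD).
have [D DP] := choice cover.
have -> : K = \bigcap_k \bigcup_(x in [set` D k]) ball x k.+1%:R^-1.
  apply/seteqP; split => [x Kx k _|x xD]; first by have [_] := DP k; exact.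
  have clK : closed K by apply: compact_closed => //; exact: norm_hausdorff.
  apply: clK => B /nbhs_ballP[e /= e0 xeB].
  have [k ke] : exists k : nat, k.+1%:R^-1 < e.
    by have [k _ /(_ k (leqnn k))] := near_infty_natSinv_lt (PosNum e0); exists k.
  have [y Dy xy] := xD k I.
  exists y; split; first by have [+ _] := DP k; exact.
  by apply: xeB; apply: ball_sym; apply: le_ball xy; exact: ltW.
apply: bigcapT_measurable => k; apply: fin_bigcup_measurable => //.
by move=> x _; exact: measurable_rV_ball.
Qed.

End geometry.

(** By induction on the dimension: [leb] adds one coordinate at a time, and [rV_cons] pulls a box
    back to an interval times a box of one dimension less. *)
Lemma leb_box_lty (R : realType) (n : nat) (r : R) :
  (leb R n [set x : 'rV[R]_n | forall i, (- r <= x ord0 i <= r)%R] < +oo)%E.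
Proof.
elim: n => [|n IH]; first by rewrite /leb /= diracE ltry.
rewrite /= /leb_step /pushforward.
set A := [set x : 'rV[R]_n | _] in IH.
have -> : rV_cons @^-1`
    [set x : 'rV[R]_n.+1 | forall i, - r <= x ord0 i <= r] =
    `[- r, r]%classic `*` A.
  apply/seteqP; split => -[a v] /=.
    move=> h; split.
      have := h ord0; have := congr1 fst (rV_consK (a, v)).
      by rewrite /rV_uncons /= => ->.
    move=> i; have := h (lift ord0 i).
    have := congr1 snd (rV_consK (a, v)).
    by rewrite /rV_uncons /= => /rowP /(_ i); rewrite mxE => ->.
  move=> [ha hv] i; have [->|[j ->]] : i = ord0 \/ exists j, i = lift ord0 j.
    by case: (unliftP ord0 i) => [j ->|->]; [right; exists j|left].
    have := congr1 fst (rV_consK (a, v)).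
    by rewrite /rV_uncons /= => ->.
  have := congr1 snd (rV_consK (a, v)).
  by rewrite /rV_uncons /= => /rowP /(_ j); rewrite mxE => ->.
have mA : measurable A.
  exact: measurable_rV_box.
rewrite [ltLHS](_ : _ = lebesgue_measure `[(- r)%R, r] * leb R n A)%E; last first.
  by apply: product_measure1E => //; exact: measurable_itv.
by rewrite lte_mul_pinfty//= lebesgue_measure_itv/=; case: ifP.
Qed.

Lemma compact_leb_lty (R : realType) (n : nat) (K : set 'rV[R]_n) :
  compact K -> (leb R n K < +oo)%E.
Proof.
move=> cK; have [M [_ MK]] := compact_bounded cK.
(* [compact_bounded] bounds the norm by every number strictly above M, whence M + 1. *)
apply: le_lt_trans (leb_box_lty n (M + 1)).
apply: le_measure.
- by apply: mem_set; exact: compact_rV_measurable.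
- by apply: mem_set; exact: measurable_rV_box.
move=> x Kx i /=; rewrite -ler_norml.
apply: le_trans (MK (M + 1) _ x Kx); last by rewrite ltrDl.
rewrite [leRHS]/Num.norm/= mx_normrE.
by apply/bigmax_geP; right; exists (ord0, i).
Qed.

(** * Real part, imaginary part and modulus of complex numbers *)

Section complex_parts.
Context {R : rcfType}.
Implicit Types z w : R[i].
Local Notation Re := (@complex.Re _).
Local Notation Im := (@complex.Im _).

Lemma cReD z w : Re (z + w) = Re z + Re w.
Proof. by case: z w => a b [c e]. Qed.

Lemma cImD z w : Im (z + w) = Im z + Im w.
Proof. by case: z w => a b [c e]. Qed.

Lemma cReB z w : Re (z - w) = Re z - Re w.
Proof. by case: z w => a b [c e]. Qed.

Lemma cImB z w : Im (z - w) = Im z - Im w.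
Proof. by case: z w => a b [c e]. Qed.

Lemma cReM z w : Re (z * w) = Re z * Re w - Im z * Im w.
Proof. by case: z w => a b [c e]. Qed.

Lemma cImM z w : Im (z * w) = Re z * Im w + Im z * Re w.
Proof. by case: z w => a b [c e]. Qed.

Lemma Re_conjc z : Re (conjc z) = Re z. Proof. by case: z. Qed.

Lemma Im_conjc z : Im (conjc z) = - Im z. Proof. by case: z. Qed.

Lemma cRe_sum I (r : seq I) (P : pred I) (F : I -> R[i]) :
  Re (\sum_(i <- r | P i) F i) = \sum_(i <- r | P i) Re (F i).
Proof.
by elim/big_rec2: _ => [|i x y _ <-]; rewrite ?cReD.
Qed.

Lemma cIm_sum I (r : seq I) (P : pred I) (F : I -> R[i]) :
  Im (\sum_(i <- r | P i) F i) = \sum_(i <- r | P i) Im (F i).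
Proof.
by elim/big_rec2: _ => [|i x y _ <-]; rewrite ?cImD.
Qed.

Lemma normc_ge0 z : 0 <= Normc.normc z.
Proof. by case: z => a b; exact: sqrtr_ge0. Qed.

Lemma normc_eq0 z : (Normc.normc z == 0) = (z == 0).
Proof.
by apply/eqP/eqP => [/Normc.eq0_normc //|->]; exact: Normc.normc0.
Qed.

Lemma normc_sqr z : Normc.normc z ^+ 2 = Re z ^+ 2 + Im z ^+ 2.
Proof. by case: z => a b; rewrite sqr_sqrtr// addr_ge0// sqr_ge0. Qed.

Lemma normc_real (a : R) : Normc.normc a%:C = `|a|.
Proof. by rewrite /= expr0n/= addr0 sqrtr_sqr. Qed.

Lemma ler_Re_normc z : `|Re z| <= Normc.normc z.
Proof.
by case: z => a b /=; rewrite -sqrtr_sqr ler_wsqrtr// lerDl sqr_ge0.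
Qed.

Lemma ler_Im_normc z : `|Im z| <= Normc.normc z.
Proof.
by case: z => a b /=; rewrite -(sqrtr_sqr b) ler_wsqrtr// lerDr sqr_ge0.
Qed.

Lemma ler_normc_ReIm z : Normc.normc z <= `|Re z| + `|Im z|.
Proof.
rewrite -[leRHS]ger0_norm ?addr_ge0// -[leRHS]sqrtr_sqr.
case: z => a b /=.
rewrite ler_wsqrtr// sqrrD !real_normK ?num_real// lerD2r lerDl.
by rewrite mulrn_wge0// mulr_ge0.
Qed.

Lemma ler_normc_sum I (r : seq I) (P : pred I) (F : I -> R[i]) :
  Normc.normc (\sum_(i <- r | P i) F i) <=
  \sum_(i <- r | P i) Normc.normc (F i).
Proof.
elim/big_rec2 : _ => [|i x y _ h]; first by rewrite Normc.normc0.
by rewrite (le_trans (le_normcD _ _))// lerD2l.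
Qed.

End complex_parts.

(** * Real square-integrable functions *)

Section square_integrable.
Context d (T : measurableType d) (R : realType).
Variables (mu : {measure set T -> \bar R}) (D : set T).
Hypothesis mD : measurable D.
Implicit Types u v : T -> R.

Definition square_integrable u :=
  measurable_fun D u /\ mu.-integrable D (EFin \o (fun x => u x ^+ 2)).

Lemma square_integrableD u v : square_integrable u -> square_integrable v ->
  square_integrable (u \+ v).
Proof.
move=> [mu_u iu] [mu_v iv]; split; first exact: measurable_funD.
apply: (le_integrable mD _ _ (integrableZl mD 2 (integrableD mD iu iv))) => /=.
  by apply/measurable_EFinP; apply: measurable_funX; exact: measurable_funD.
move=> x _ /=; rewrite lee_fin !ger0_norm ?sqr_ge0//; last first.
  by rewrite mulr_ge0// addr_ge0// sqr_ge0.
by have := sqr_ge0 (u x - v x); nra.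
Qed.

Lemma square_integrableZ (a : R) u : square_integrable u ->
  square_integrable (fun x => a * u x).
Proof.
move=> [mu_u iu]; split.
  by apply: measurable_funM => //; exact: measurable_cst.
have := integrableZl mD (a ^+ 2) iu.
by apply: eq_integrable => // x _; rewrite /= -EFinM exprMn.
Qed.

Lemma square_integrableM u v : square_integrable u -> square_integrable v ->
  mu.-integrable D (EFin \o (fun x => u x * v x)).
Proof.
move=> [mu_u iu] [mu_v iv].
apply: (le_integrable mD _ _ (integrableD mD iu iv)) => /=.
  by apply/measurable_EFinP; exact: measurable_funM.
move=> x _ /=; rewrite lee_fin [leRHS]ger0_norm ?addr_ge0 ?sqr_ge0//.
rewrite ler_norml; apply/andP; split.
  by have := sqr_ge0 (u x + v x); have := sqr_ge0 (u x); have := sqr_ge0 (v x); nra.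
by have := sqr_ge0 (u x - v x); have := sqr_ge0 (u x); have := sqr_ge0 (v x); nra.
Qed.

Hypothesis fD : (mu D < +oo)%E.

Lemma bounded_square_integrable u (K : R) : measurable_fun D u ->
  (forall x, D x -> `|u x| <= K) -> square_integrable u.
Proof.
move=> mu_u uK; split => //; apply: measurable_bounded_integrable => //.
  exact: measurable_funX.
exists (K ^+ 2); split; first exact: num_real.
move=> M KM x /= Dx; apply: le_trans (ltW KM).
by rewrite normrX lerXn2r ?nnegrE ?(le_trans _ (uK x Dx))// uK.
Qed.

(** On a set of finite measure the constant 1 is square-integrable, and u is its product with 1. *)
Lemma square_integrable_integrable u : square_integrable u ->
  mu.-integrable D (EFin \o u).
Proof.
move=> iu; have i1 : square_integrable (cst 1).
  by apply: (bounded_square_integrable (K := 1)) => // x _; rewrite normr1.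
have := square_integrableM iu i1.
by apply: eq_integrable => // x _; rewrite /= mulr1.
Qed.

End square_integrable.

(** * Integrals of complex functions and their L^2 estimates *)

Section complex_integral.
Context {R : realType} {d : nat}.
Local Notation E := 'rV[R]_d.
Local Notation C := R[i].
Local Notation mu := (leb R d).
Local Notation Re := (@complex.Re _).
Local Notation Im := (@complex.Im _).
Variable Omega : set E.
Hypothesis mO : measurable Omega.
Implicit Types f g h : E -> C.

Definition cintegrable f :=
  mu.-integrable Omega (EFin \o (Re \o f)) /\
  mu.-integrable Omega (EFin \o (Im \o f)).

Definition csquare_integrable f :=
  square_integrable mu Omega (Re \o f) /\
  square_integrable mu Omega (Im \o f).

Lemma eq_cint f g : (forall x, Omega x -> f x = g x) ->
  cint Omega f = cint Omega g.
Proof.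
by move=> fg; rewrite /cint; congr (_ +i* _); apply: eq_Rintegral => x /set_mem /fg ->.
Qed.

Lemma eq_cintegrable f g : (forall x, Omega x -> f x = g x) ->
  cintegrable f -> cintegrable g.
Proof.
move=> fg [i1 i2]; split; [move: i1|move: i2];
  by apply: eq_integrable => // x /set_mem /fg /= ->.
Qed.

Lemma cintegrableD f g : cintegrable f -> cintegrable g ->
  cintegrable (fun x => f x + g x).
Proof.
move=> [f1 f2] [g1 g2]; split.
  by move: (integrableD mO f1 g1); apply: eq_integrable => // x _ /=; rewrite cReD EFinD.
by move: (integrableD mO f2 g2); apply: eq_integrable => // x _ /=; rewrite cImD EFinD.
Qed.

Lemma cintD f g : cintegrable f -> cintegrable g ->
  cint Omega (fun x => f x + g x) = cint Omega f + cint Omega g.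
Proof.
move=> [f1 f2] [g1 g2]; rewrite /cint.
under eq_Rintegral do rewrite cReD.
under [X in _ +i* X]eq_Rintegral do rewrite cImD.
by rewrite !RintegralD.
Qed.

Lemma cintegrableZ (a : C) f : cintegrable f -> cintegrable (fun x => a * f x).
Proof.
move=> [f1 f2]; split.
  move: (integrableB mO (integrableZl mO (Re a) f1) (integrableZl mO (Im a) f2)).
  by apply: eq_integrable => // x _ /=; rewrite cReM EFinD EFinN !EFinM.
move: (integrableD mO (integrableZl mO (Re a) f2) (integrableZl mO (Im a) f1)).
by apply: eq_integrable => // x _ /=; rewrite cImM EFinD !EFinM.
Qed.

Lemma cintZ (a : C) f : cintegrable f ->
  cint Omega (fun x => a * f x) = a * cint Omega f.
Proof.
move=> [f1 f2]; rewrite /cint.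
under eq_Rintegral do rewrite cReM.
under [X in _ +i* X]eq_Rintegral do rewrite cImM.
have Z (b : R) (u : E -> R) : mu.-integrable Omega (EFin \o u) ->
    mu.-integrable Omega (EFin \o (fun x => b * u x)).
  by move=> iu; move: (integrableZl mO b iu); apply: eq_integrable.
rewrite RintegralB ?RintegralD//; try exact: Z.
by rewrite !RintegralZl//; case: a.
Qed.

Lemma cintegrable_sum I (r : seq I) (F : I -> E -> C) :
  (forall i, cintegrable (F i)) -> cintegrable (fun x => \sum_(i <- r) F i x).
Proof.
move=> iF; elim: r => [|i r IH].
  apply: (eq_cintegrable (f := fun=> 0)) => [x _|]; first by rewrite big_nil.
  by split; exact: integrable0.
apply: (eq_cintegrable (f := fun x => F i x + \sum_(i <- r) F i x)) => [x _|].
  by rewrite big_cons.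
exact: cintegrableD.
Qed.

Lemma cint_sum I (r : seq I) (F : I -> E -> C) :
  (forall i, cintegrable (F i)) ->
  cint Omega (fun x => \sum_(i <- r) F i x) = \sum_(i <- r) cint Omega (F i).
Proof.
move=> iF; elim: r => [|i r IH].
  rewrite big_nil (@eq_cint _ (fun=> 0)); last by move=> x _; rewrite big_nil.
  by rewrite /cint /= !Rintegral_cst// mul0r.
rewrite big_cons -IH -cintD//; last exact: cintegrable_sum.
by apply: eq_cint => x _; rewrite big_cons.
Qed.

Lemma csquare_integrableD f g : csquare_integrable f -> csquare_integrable g ->
  csquare_integrable (fun x => f x + g x).
Proof.
move=> [f1 f2] [g1 g2]; split.
  rewrite (_ : _ \o _ = (Re \o f) \+ (Re \o g)); first exact: square_integrableD.
  by apply/funext => x /=; rewrite cReD.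
rewrite (_ : _ \o _ = (Im \o f) \+ (Im \o g)); first exact: square_integrableD.
by apply/funext => x /=; rewrite cImD.
Qed.

Lemma csquare_integrableZ (a : C) f : csquare_integrable f ->
  csquare_integrable (fun x => a * f x).
Proof.
move=> [f1 f2]; split.
  rewrite (_ : _ \o _ = (fun x => Re a * (Re \o f) x) \+
      (fun x => (- Im a) * (Im \o f) x)); last first.
    by apply/funext => x /=; rewrite cReM mulNr.
  by apply: square_integrableD => //; exact: square_integrableZ.
rewrite (_ : _ \o _ = (fun x => Re a * (Im \o f) x) \+
    (fun x => Im a * (Re \o f) x)); last first.
  by apply/funext => x /=; rewrite cImM.
by apply: square_integrableD => //; exact: square_integrableZ.
Qed.

Lemma csquare_integrableB f g : csquare_integrable f -> csquare_integrable g ->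
  csquare_integrable (fun x => f x - g x).
Proof.
move=> sf sg; have := csquare_integrableD sf (csquare_integrableZ (-1) sg).
by under eq_fun do rewrite mulN1r.
Qed.

Lemma csquare_integrableJ f : csquare_integrable f ->
  csquare_integrable (fun x => conjc (f x)).
Proof.
move=> [f1 f2]; split.
  rewrite (_ : _ \o _ = Re \o f)//.
  by apply/funext => x /=; rewrite Re_conjc.
rewrite (_ : _ \o _ = fun x => (-1) * (Im \o f) x); last first.
  by apply/funext => x /=; rewrite Im_conjc mulN1r.
exact: square_integrableZ.
Qed.

Lemma csquare_integrableM f g : csquare_integrable f -> csquare_integrable g ->
  cintegrable (fun x => f x * g x).
Proof.
move=> [f1 f2] [g1 g2]; split.
  move: (integrableB mO (square_integrableM mO f1 g1) (square_integrableM mO f2 g2)).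
  by apply: eq_integrable => // x _ /=; rewrite cReM EFinD EFinN.
move: (integrableD mO (square_integrableM mO f1 g2) (square_integrableM mO f2 g1)).
by apply: eq_integrable => // x _ /=; rewrite cImM EFinD.
Qed.

Lemma csquare_integrable_sum I (r : seq I) (F : I -> E -> C) :
  (forall i, csquare_integrable (F i)) ->
  csquare_integrable (fun x => \sum_(i <- r) F i x).
Proof.
move=> iF; elim: r => [|i r IH].
  under eq_fun do rewrite big_nil.
  have z : square_integrable mu Omega (fun=> 0).
    split; first exact: measurable_cst.
    by under eq_fun do rewrite expr0n/=; exact: integrable0.
  by split.
under eq_fun do rewrite big_cons.
exact: csquare_integrableD.
Qed.

Lemma inner_sum I (r : seq I) (a : I -> C) (F : I -> E -> C) g :
  (forall i, csquare_integrable (F i)) -> csquare_integrable g ->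
  inner Omega (fun x => \sum_(i <- r) a i * F i x) g =
  \sum_(i <- r) a i * inner Omega (F i) g.
Proof.
move=> iF ig; have jg := csquare_integrableJ ig.
rewrite /inner (@eq_cint _ (fun x => \sum_(i <- r) a i * (F i x * conjc (g x)))).
  rewrite cint_sum; last first.
    by move=> i; apply: cintegrableZ; exact: csquare_integrableM.
  apply: eq_bigr => i _; rewrite cintZ//; exact: csquare_integrableM.
by move=> x _; rewrite mulr_suml; apply: eq_bigr => i _; rewrite mulrA.
Qed.

Lemma csquare_integrable_cmeasurable f :
  csquare_integrable f -> cmeasurable Omega f.
Proof. by move=> [[? _] [? _]]. Qed.

Lemma measurable_normc f : cmeasurable Omega f ->
  measurable_fun Omega (fun x => Normc.normc (f x)).
Proof.
move=> [m1 m2].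
rewrite (_ : (fun _ => _) = @Num.sqrt R \o
    ((fun x => Re (f x) ^+ 2) \+ (fun x => Im (f x) ^+ 2))).
  apply: measurableT_comp.
    by apply: continuous_measurable_fun; exact: sqrt_continuous.
  by apply: measurable_funD; exact: measurable_funX.
by apply/funext => x /=; case: (f x).
Qed.

Lemma measurable_normc_indic f : cmeasurable Omega f ->
  measurable_fun setT (fun x => Normc.normc (f x) * \1_Omega x).
Proof.
move=> mf; rewrite (_ : (fun _ => _) = (fun x => Normc.normc (f x)) \_ Omega).
  by apply/(measurable_restrict _ mO measurableT); rewrite setTI; exact: measurable_normc.
apply/funext => x; rewrite /patch indicE.
by case: (x \in Omega); rewrite ?mulr1 ?mulr0.
Qed.

Lemma Lqnorm2E f : Lqnorm Omega 2 f =
  ((\int[mu]_(x in Omega) (Normc.normc (f x) ^+ 2)%:E) `^ 2^-1)%E.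
Proof.
rewrite /Lqnorm unlock; congr (_ `^ _)%E.
rewrite [RHS]integral_mkcond; apply: eq_integral => x _.
rewrite /= powR_mulrn// real_normK ?num_real// /patch indicE.
by case: (x \in Omega); rewrite ?mulr1 // mulr0 expr0n.
Qed.

Lemma inLq2_csquare_integrable f : inLq Omega 2 f -> csquare_integrable f.
Proof.
move=> [mf]; rewrite Lqnorm2E => /lty_poweRy foo.
have {foo} : mu.-integrable Omega (EFin \o (fun x => Normc.normc (f x) ^+ 2)).
  apply/integrableP; split.
    by apply/measurable_EFinP; apply: measurable_funX; exact: measurable_normc.
  under eq_integral do rewrite /= ger0_norm ?sqr_ge0//.
  by apply: foo; rewrite invr_eq0.
case: mf => m1 m2 i; split; split => //; apply: le_integrable i => //=.
- by apply/measurable_EFinP; exact: measurable_funX.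
- move=> x _; by rewrite lee_fin !ger0_norm ?sqr_ge0// normc_sqr lerDl sqr_ge0.
- by apply/measurable_EFinP; exact: measurable_funX.
- move=> x _; by rewrite lee_fin !ger0_norm ?sqr_ge0// normc_sqr lerDr sqr_ge0.
Qed.

Hypothesis fO : (mu Omega < +oo)%E.

Lemma csquare_integrable_cintegrable f :
  csquare_integrable f -> cintegrable f.
Proof.
by move=> [f1 f2]; split; exact: square_integrable_integrable.
Qed.

Lemma bounded_csquare_integrable f (K : R) : cmeasurable Omega f ->
  (forall x, Omega x -> Normc.normc (f x) <= K) -> csquare_integrable f.
Proof.
move=> [m1 m2] fK; split; apply: (bounded_square_integrable _ _ (K := K)) => //= x Ox.
  exact: le_trans (ler_Re_normc _) (fK x Ox).
exact: le_trans (ler_Im_normc _) (fK x Ox).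
Qed.

(** The factor 2 arises because real and imaginary parts are estimated separately; it ends up in the
    final constant. *)
Lemma normc_cint_le f (K : R) : cmeasurable Omega f ->
  (forall x, Omega x -> Normc.normc (f x) <= K) ->
  Normc.normc (cint Omega f) <= 2 * (K * fine (mu Omega)).
Proof.
move=> mf fK.
have [i1 i2] := csquare_integrable_cintegrable (bounded_csquare_integrable mf fK).
rewrite (le_trans (ler_normc_ReIm _))// mulr_natl mulr2n lerD//=.
  rewrite (le_trans (le_normr_Rintegral _ _))// -Rintegral_cst//.
  apply: le_Rintegral => //.
  - exact: integrable_norm.
  - by apply: measurable_bounded_integrable => //; exact: bounded_cst.
  - by move=> x Ox; exact: le_trans (ler_Re_normc _) (fK x Ox).
rewrite (le_trans (le_normr_Rintegral _ _))// -Rintegral_cst//.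
apply: le_Rintegral => //.
- exact: integrable_norm.
- by apply: measurable_bounded_integrable => //; exact: bounded_cst.
- by move=> x Ox; exact: le_trans (ler_Im_normc _) (fK x Ox).
Qed.

Lemma normc_cint_Lq f : csquare_integrable f ->
  ((Normc.normc (cint Omega f))%:E <=
    2%:E * (Lqnorm Omega 2 f * Lqnorm Omega 2 (fun=> 1%R)))%E.
Proof.
move=> sf; have mf := csquare_integrable_cmeasurable sf.
have m1 : cmeasurable Omega (fun=> 1) by split; exact: measurable_cst.
have [i1 i2] := csquare_integrable_cintegrable sf.
set B := (_ * Lqnorm _ _ _)%E.
have part (u : E -> R) : mu.-integrable Omega (EFin \o u) ->
    (forall x, `|u x| <= Normc.normc (f x)) ->
    ((`|\int[mu]_(x in Omega) u x|%R)%:E <= B)%E.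
  move=> iu uf; rewrite EFin_normr_Rintegral//.
  have mu_u : measurable_fun Omega u by case/integrableP : iu => /measurable_EFinP.
  apply: (le_trans (le_abse_integral _ _ _)) => //; first exact/measurable_EFinP.
  (* Cauchy-Schwarz against the constant 1. Both factors carry the indicator of Omega because
     [Lqnorm] is a norm over the whole space. *)
  have := hoelder mu (measurable_normc_indic mf) (measurable_normc_indic m1)
    (ltr0n _ 2) (ltr0n _ 2).
  have e2 : 2^-1 + 2^-1 = 1 :> R by lra.
  move=> /(_ e2); apply: le_trans.
  rewrite Lnorm1 integral_mkcond; apply: ge0_le_integral => //.
  - by move=> x _; rewrite erestrict_ge0.
  - apply/(measurable_restrict _ mO measurableT); rewrite setTI.
    by apply: measurableT_comp => //; exact/measurable_EFinP.
  - apply: measurableT_comp => //; apply/measurable_EFinP.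
    by apply: measurable_funM; exact: measurable_normc_indic.
  - move=> x _; rewrite /patch /= indicE expr1n expr0n addr0 sqrtr1; case: (x \in Omega).
      by rewrite !mulr1 lee_fin (le_trans (uf x))// ler_norm.
    by rewrite !mulr0 normr0.
rewrite (_ : 2%:E * B = B + B)%E; last by rewrite mule_natl mule2n.
apply: le_trans (leeD (part _ i1 _) (part _ i2 _)).
- by rewrite -EFinD lee_fin ler_normc_ReIm.
- by move=> x; exact: ler_Re_normc.
- by move=> x; exact: ler_Im_normc.
Qed.

(** On a set of finite measure the integral is continuous for the L^2 norm. The form suits the
    partial sums of the wavelet expansion, whose integrals do not depend on the length of the
    sum. *)
Lemma cint_Lq_cvg f (F : nat -> E -> C) (I : C) : csquare_integrable f ->
  (forall n, csquare_integrable (F n)) -> (forall n, cint Omega (F n) = I) ->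
  (fun n => Lqnorm Omega 2 (fun x => f x - F n x)) @ \oo --> 0%E ->
  cint Omega f = I.
Proof.
move=> sf sF FI lim0.
have K1 : Lqnorm Omega 2 (fun=> 1%R) \is a fin_num.
  rewrite ge0_fin_numE ?Lnorm_ge0// Lqnorm2E poweR_lty//.
  under eq_integral do rewrite Normc.normc1 expr1n.
  by rewrite integral_cst// mul1e.
have bnd n : ((Normc.normc (cint Omega f - I))%:E <=
    2%:E * (Lqnorm Omega 2 (fun x => f x - F n x)%R * Lqnorm Omega 2 (fun=> 1%R)))%E.
  have := normc_cint_Lq (csquare_integrableB sf (sF n)).
  rewrite (_ : cint Omega (fun x => f x - F n x) = cint Omega f - I)//.
  rewrite -(FI n) -[in RHS]mulN1r -cintZ; last exact: csquare_integrable_cintegrable.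
  rewrite -cintD; first by apply: eq_cint => x _; rewrite mulN1r.
    exact: csquare_integrable_cintegrable.
  by apply: cintegrableZ; exact: csquare_integrable_cintegrable.
have cv : (fun n => 2%:E * (Lqnorm Omega 2 (fun x => f x - F n x)%R *
    Lqnorm Omega 2 (fun=> 1%R)))%E @ \oo --> 0%E.
  rewrite -[X in _ --> X](_ : 2%:E * (0 * Lqnorm Omega 2 (fun=> 1%R)) = 0)%E.
    by apply: cvgeZl => //; apply: cvgeZr.
  by rewrite mul0e mule0.
have le0 : ((Normc.normc (cint Omega f - I))%:E <= 0)%E.
  by apply: cvge_ge cv; apply: nearW.
apply/eqP; rewrite -subr_eq0 -normc_eq0.
by rewrite eq_le normc_ge0 andbT -lee_fin.
Qed.

End complex_integral.

(** * Uniform bounds and geometric convergence *)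

Section sup_norm.
Context {R : realType} {d : nat}.
Variable Omega : set 'rV[R]_d.
Implicit Types f : 'rV[R]_d -> R[i].

Lemma supnorm_leP f (K : R) : (supnorm Omega f <= K%:E)%E <->
  (forall x, Omega x -> Normc.normc (f x) <= K).
Proof.
split=> [h x Ox|h].
  by rewrite -lee_fin (le_trans _ h)//; apply: ereal_sup_ubound; exists x.
by apply: ge_ereal_sup => _ [x Ox <-]; rewrite lee_fin h.
Qed.

(** The crude bound K serves only to make the supremum S finite. Improvement at k = S then gives S
    <= eta S + rho, and no trace of K remains. *)
Lemma normc_le_of_self_improving f (eta rho K : R) :
  Omega !=set0 -> eta < 1 -> (forall x, Omega x -> Normc.normc (f x) <= K) ->
  (forall k, (forall x, Omega x -> Normc.normc (f x) <= k) ->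
    forall x, Omega x -> Normc.normc (f x) <= eta * k + rho) ->
  forall x, Omega x -> Normc.normc (f x) <= rho / (1 - eta).
Proof.
move=> [x0 Ox0] eta1 fK improve x Ox.
pose A := [set Normc.normc (f y) | y in Omega].
have Aub : has_ubound A by exists K => _ [y Oy <-]; exact: fK.
have fA y : Omega y -> Normc.normc (f y) <= sup A.
  by move=> Oy; apply: ub_le_sup => //; exists y.
apply: (le_trans (fA x Ox)); rewrite ler_pdivlMr ?subr_gt0//.
suff : sup A <= eta * sup A + rho by lra.
apply: ge_sup; first by exists (Normc.normc (f x0)), x0.
by move=> _ [y Oy <-]; exact: improve.
Qed.

End sup_norm.

Lemma complex_geometric_cvg (R : realType) (z : nat -> R[i]) (l : R[i])
    (eta B : R) : 0 < eta < 1 ->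
  (forall n, Normc.normc (z n - l) <= B * eta ^+ n) ->
  (fun n => complex.Re (z n)) @ \oo --> complex.Re l /\
  (fun n => complex.Im (z n)) @ \oo --> complex.Im l.
Proof.
move=> /andP[eta0 eta1] zl.
have B0 : (fun n => B * eta ^+ n) @ \oo --> 0.
  rewrite -(mulr0 B); apply: cvgMr; apply: cvg_expr.
  by rewrite ger0_norm// ltW.
have part (u : nat -> R) (a : R) : (forall n, `|u n - a| <= B * eta ^+ n) ->
    u @ \oo --> a.
  move=> ua; apply/cvgrPdist_le => e e0.
  move/cvgrPdist_le : B0 => /(_ e e0); apply: filterS => n /=.
  rewrite sub0r normrN distrC => /(le_trans (ler_norm _)).
  exact: le_trans.
split; apply: part => n; apply: le_trans (zl n).
  by rewrite -cReB ler_Re_normc.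
by rewrite -cImB ler_Im_normc.
Qed.

(** * Convergence of INTEGRATE and reduction of its error to the projection error at the samples *)

Section iteration.
Context {R : realType} {d : nat}.
Local Notation E := 'rV[R]_d.
Local Notation C := R[i].
Local Notation mu := (leb R d).
Variables (Omega : set E) (V : mra_data R d) (J M : nat).
Variables (X : 'I_M.+1 -> E) (psi : 'I_M.+1 -> E -> R) (eta : R).
Local Notation N := (mra_N V J).
Local Notation phi := (mra_phi (m := V) (j := J)).
Local Notation phit := (mra_dual (m := V) (j := J)).
Local Notation mxM := (mxM Omega V J psi).
Local Notation mxPhi := (mxPhi V J X).
Local Notation omega := (omega Omega V J).

Hypothesis mO : measurable Omega.
Hypothesis fO : (mu Omega < +oo)%E.
Hypothesis basis : is_basis Omega (mra_space V J) phi.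
Hypothesis sphi : forall k, csquare_integrable Omega (fun x => (phi k x)%:C).
Hypothesis sphit : forall k, csquare_integrable Omega (phit k).
Hypothesis phi_ub : exists K : R, forall k x, Omega x -> `|phi k x| <= K.
Hypothesis XO : forall l, Omega (X l).
Hypothesis mpsi : forall l, measurable_fun Omega (psi l).
Hypothesis psi01 : forall l x, Omega x -> 0 <= psi l x <= 1.
Hypothesis psi1 : forall x, Omega x -> \sum_l psi l x = 1.
Hypothesis eta01 : 0 < eta < 1.
Hypothesis contraction : forall g, mra_space V J g ->
  (supnorm Omega
     (fun x => g x - mra_proj Omega V J (quasi_interp X psi g) x)%R
   <= eta%:E * supnorm Omega g)%E.
Hypothesis P_fin : (mra_proj_norm Omega V J < +oo)%E.

Let O0 : Omega !=set0. Proof. by exists (X ord0). Qed.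

Definition lincomb (c : 'cV[C]_N.+1) (x : E) : C :=
  \sum_k c k ord0 * (phi k x)%:C.

Definition coefs (f : E -> C) : 'cV[C]_N.+1 :=
  \col_k inner Omega f (phit k).

Lemma lincombB c e x : lincomb (c - e) x = lincomb c x - lincomb e x.
Proof.
rewrite /lincomb -sumrB; apply: eq_bigr => k _.
by rewrite !mxE mulrBl.
Qed.

Lemma lincombD c e x : lincomb (c + e) x = lincomb c x + lincomb e x.
Proof.
rewrite /lincomb -big_split; apply: eq_bigr => k _.
by rewrite !mxE mulrDl.
Qed.

Lemma mra_projE f x : mra_proj Omega V J f x = lincomb (coefs f) x.
Proof. by apply: eq_bigr => k _; rewrite mxE. Qed.

Lemma lincomb_space c : mra_space V J (lincomb c).
Proof. by apply/(basis.1 _).2; exists (fun k => c k ord0). Qed.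

Lemma lincomb_eq0 c : (forall x, Omega x -> lincomb c x = 0) -> c = 0.
Proof.
move=> /(basis.2 (fun k => c k ord0)) c0.
by apply/matrixP => k i; rewrite ord1 c0 mxE.
Qed.

Lemma csquare_integrable_lincomb c : csquare_integrable Omega (lincomb c).
Proof.
by apply: csquare_integrable_sum => // k; exact: csquare_integrableZ.
Qed.

Lemma lincomb_bounded c :
  exists2 K : R, 0 <= K & forall x, Omega x -> Normc.normc (lincomb c x) <= K.
Proof.
have [K phiK] := phi_ub.
have K0 : 0 <= K by apply: le_trans (phiK ord0 _ (XO ord0)).
exists (\sum_k Normc.normc (c k ord0) * K).
  by apply: sumr_ge0 => k _; rewrite mulr_ge0// normc_ge0.
move=> x Ox; apply: (le_trans (ler_normc_sum _ _ _)).
apply: ler_sum => k _.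
by rewrite Normc.normcM normc_real ler_wpM2l ?normc_ge0// phiK.
Qed.

Lemma cint_lincomb c : cint Omega (lincomb c) = (omega^T *m c) ord0 ord0.
Proof.
rewrite /lincomb cint_sum//; last first.
  by move=> k; apply: csquare_integrable_cintegrable => //; exact: csquare_integrableZ.
rewrite mxE; apply: eq_bigr => k _; rewrite !mxE mulrC cintZ//.
exact: csquare_integrable_cintegrable.
Qed.

Lemma csquare_integrable_psi l :
  csquare_integrable Omega (fun x => (psi l x)%:C).
Proof.
apply: (@bounded_csquare_integrable _ _ _ mO fO _ 1) => // [|x Ox].
  by split => //=; exact: measurable_cst.
by have /andP[p0 p1] := psi01 l Ox; rewrite normc_real ger0_norm.
Qed.

(** Together with [samples_lincomb] this identifies [mxM *m mxPhi] as the matrix of P_J Q on V_J in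
    the basis phi. *)
Lemma coefs_quasi_interp f :
  coefs (quasi_interp X psi f) = mxM *m samples X f.
Proof.
apply/matrixP => k i; rewrite ord1 !mxE /quasi_interp inner_sum//; last first.
  exact: csquare_integrable_psi.
by apply: eq_bigr => l _; rewrite !mxE mulrC.
Qed.

Lemma samples_lincomb c : samples X (lincomb c) = mxPhi *m c.
Proof.
apply/matrixP => l i; rewrite ord1 !mxE; apply: eq_bigr => k _.
by rewrite !mxE mulrC.
Qed.

Lemma lincomb_contraction c (K : R) :
  (forall x, Omega x -> Normc.normc (lincomb c x) <= K) ->
  forall x, Omega x ->
    Normc.normc (lincomb (c - mxM *m mxPhi *m c) x) <= eta * K.
Proof.
move=> cK; apply/supnorm_leP.
have -> : lincomb (c - mxM *m mxPhi *m c) =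
    (fun x => lincomb c x - mra_proj Omega V J (quasi_interp X psi (lincomb c)) x).
  apply/funext => x.
  by rewrite lincombB mra_projE coefs_quasi_interp samples_lincomb mulmxA.
apply: (le_trans (contraction (lincomb_space c))).
rewrite EFinM lee_pmul2l ?lte_fin//; last by case/andP : eta01.
exact/supnorm_leP.
Qed.

(** Write e = (e - T e) + r. By the contraction, a bound k for the function of e improves to eta k +
    rho. The lemma serves twice: for the injectivity of T and for the final error. *)
Lemma lincomb_fixpoint_bound (e r : 'cV[C]_N.+1) (rho : R) :
  mxM *m mxPhi *m e = r ->
  (forall x, Omega x -> Normc.normc (lincomb r x) <= rho) ->
  forall x, Omega x -> Normc.normc (lincomb e x) <= rho / (1 - eta).
Proof.
move=> er rrho; have [K _ eK] := lincomb_bounded e.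
apply: (normc_le_of_self_improving O0 _ eK); first by case/andP : eta01.
move=> k ek x Ox; have := lincomb_contraction ek Ox; rewrite er => ek'.
rewrite -[e](subrK r) lincombD (le_trans (le_normcD _ _))// lerD//.
exact: rrho.
Qed.

(** If T e = 0, the preceding bound with rho = 0 makes the function of e vanish on Omega, so e = 0
    by linear independence of the basis. *)
Lemma mxMPhi_unit : mxM *m mxPhi \in unitmx.
Proof.
(* [det0P] yields a row vector in the left kernel, hence the transposition. *)
rewrite -unitmx_tr unitmxE unitfE; apply/det0P => -[v v0 vA].
move/eqP : v0; apply; apply: trmx_inj; rewrite trmx0; apply: lincomb_eq0 => x Ox.
have er : mxM *m mxPhi *m v^T = 0 by apply: trmx_inj; rewrite trmx_mul trmxK trmx0.
apply/eqP; rewrite -normc_eq0 eq_le normc_ge0 andbT.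
rewrite -(mul0r (1 - eta)^-1); apply: (lincomb_fixpoint_bound er) => // y _.
rewrite /lincomb big1 ?Normc.normc0// => k _.
by rewrite mxE mul0r.
Qed.

Section limit.
Variable v : 'cV[C]_M.+1.

(** The fixed point of [coef_step]; for v the samples of f it holds the coefficients of the g with T
    g = P_J Q f. *)
Let cs : 'cV[C]_N.+1 := invmx (mxM *m mxPhi) *m (mxM *m v).

Let csE : mxM *m mxPhi *m cs = mxM *m v.
Proof. by rewrite /cs mulmxA mulmxV ?mul1mx// mxMPhi_unit. Qed.

Let coef_step (c : 'cV[C]_N.+1) := c + mxM *m (v - mxPhi *m c).

(** The pair (I, u) of INTEGRATE is a linear image of one coefficient vector c: I is the integral of
    its function and u are its samples. All analysis can then take place on c. *)
Let integrate_coef n :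
  iter n (integrate_step Omega V J X psi v) (integrate_init Omega V J X psi v) =
  ((omega^T *m iter n coef_step (mxM *m v)) ord0 ord0,
   mxPhi *m iter n coef_step (mxM *m v)).
Proof.
elim: n => [|n IH].
  by rewrite /= /integrate_init /mxPQ !mulmxA.
rewrite !iterS IH /integrate_step /=.
set c := iter _ _ _; rewrite /coef_step; congr (_, _).
  by rewrite [in RHS]mulmxDr [RHS]mxE mulmxA.
by rewrite [RHS]mulmxDr /mxPQ mulmxA.
Qed.

Let coef_error : exists2 K : R, 0 <= K & forall n x, Omega x ->
   Normc.normc (lincomb (iter n coef_step (mxM *m v) - cs) x) <= K * eta ^+ n.
Proof.
have [K K0 cK] := lincomb_bounded (mxM *m v - cs).
exists K => //; elim=> [|n IH] x Ox; first by rewrite expr0 mulr1 cK.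
rewrite iterS; set c := iter _ _ _ in IH *.
(* One step multiplies the error by I - T, which the contraction hypothesis controls. *)
have -> : coef_step c - cs = (c - cs) - mxM *m mxPhi *m (c - cs).
  by rewrite /coef_step mulmxBr mulmxA mulmxBr csE opprB addrAC.
by rewrite exprS mulrCA; apply: lincomb_contraction.
Qed.

Lemma integrate_cvg :
  integrate_converges Omega V J X psi v /\
  integrate_oo Omega V J X psi v = cint Omega (lincomb cs).
Proof.
have [K K0 cK] := coef_error.
set I := cint Omega (lincomb cs).
(* [integrate] at n is the result of n+1 steps; the surplus factor eta is moved into the
   constant. *)
have bnd n : Normc.normc (integrate Omega V J X psi n v - I) <=
    (2 * (K * eta * fine (mu Omega))) * eta ^+ n.
  rewrite /integrate integrate_coef; set c := iter n.+1 coef_step _.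
  rewrite [X in X - I]/= -cint_lincomb.
  have -> : cint Omega (lincomb c) - I = cint Omega (lincomb (c - cs)).
    by rewrite /I !cint_lincomb mulmxBr !mxE.
  have := normc_cint_le mO fO
    (csquare_integrable_cmeasurable (csquare_integrable_lincomb (c - cs))) (cK n.+1).
  move=> /le_trans; apply; rewrite exprS.
  suff -> : K * (eta * eta ^+ n) * fine (mu Omega) =
    K * eta * fine (mu Omega) * eta ^+ n by rewrite mulrA.
  by ring.
have [cvRe cvIm] := complex_geometric_cvg eta01 bnd.
split; first by split; apply/cvg_ex; [exists (complex.Re I)|exists (complex.Im I)].
rewrite /integrate_oo.
transitivity (complex.Re I +i* complex.Im I); last by case: (I).
by congr (_ +i* _); exact/cvg_lim.
Qed.

End limit.

(** The operator norm is a supremum over the unit ball, so f is rescaled by 1/rho, and finiteness of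
    the norm makes [fine] faithful. *)
Lemma mra_proj_bound f (rho : R) : cmeasurable Omega f ->
  (forall x, Omega x -> Normc.normc (f x) <= rho) ->
  forall x, Omega x ->
    Normc.normc (mra_proj Omega V J f x) <= fine (mra_proj_norm Omega V J) * rho.
Proof.
move=> mf frho x Ox.
have rho0 : 0 <= rho by apply: le_trans (normc_ge0 _) (frho x Ox).
have sf := bounded_csquare_integrable mO fO mf frho.
have innerZ (a : C) k : inner Omega (fun x => a * f x) (phit k) =
    a * inner Omega f (phit k).
  have := inner_sum mO [:: tt] (fun=> a) (fun=> sf) (sphit k).
  by rewrite big_seq1 => <-; under [in RHS]eq_fun do rewrite big_seq1.
(* For rho = 0 no rescaling is possible, but then f vanishes on Omega and so do all its inner
   products. *)
have [rho_eq0|rho_neq0] := eqVneq rho 0.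
  rewrite /mra_proj big1 ?Normc.normc0 ?rho_eq0 ?mulr0// => k _.
  rewrite (_ : inner _ _ _ = 0) ?mul0r// -(mul0r (inner Omega f (phit k))) -innerZ.
  apply: eq_cint => y Oy; rewrite mul0r.
  suff -> : f y = 0 by [].
  by apply/eqP; rewrite -normc_eq0 eq_le normc_ge0 andbT -rho_eq0 frho.
pose g y := rho^-1%:C * f y.
have gP : (supnorm Omega (mra_proj Omega V J g) <= mra_proj_norm Omega V J)%E.
  apply: ereal_sup_ubound; exists g => //; split.
    case: mf => m1 m2; split.
      rewrite (_ : (fun _ => _) = (fun x => rho^-1 * complex.Re (f x))).
        by apply: measurable_funM => //; exact: measurable_cst.
      by apply/funext => y; rewrite cReM /= mul0r subr0.
    rewrite (_ : (fun _ => _) = (fun x => rho^-1 * complex.Im (f x))).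
      by apply: measurable_funM => //; exact: measurable_cst.
    by apply/funext => y; rewrite cImM /= mul0r addr0.
  apply/supnorm_leP => y Oy.
  rewrite /g Normc.normcM normc_real ger0_norm ?invr_ge0//.
  by rewrite mulrC ler_pdivrMr ?mul1r ?frho// lt_def rho_neq0.
have gx : ((Normc.normc (mra_proj Omega V J g x))%:E <= mra_proj_norm Omega V J)%E.
  by apply: le_trans gP; apply: ereal_sup_ubound; exists x.
have Pfin : mra_proj_norm Omega V J \is a fin_num.
  by rewrite ge0_fin_numE// (le_trans _ gx)// lee_fin normc_ge0.
move: gx; rewrite -(fineK Pfin) lee_fin -ler_pdivrMr ?lt_def ?rho_neq0//.
suff -> : mra_proj Omega V J g x = rho^-1%:C * mra_proj Omega V J f x.
  by rewrite Normc.normcM normc_real ger0_norm ?invr_ge0// mulrC.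
by rewrite /mra_proj mulr_sumr; apply: eq_bigr => k _; rewrite innerZ mulrA.
Qed.

(** A bound at the sample points suffices, since P_J Q h depends on h only through its samples. The
    function f enters through its integral and its projection, [fc] through its samples. *)
Lemma integrate_error f fc (rho : R) :
  cint Omega f = cint Omega (mra_proj Omega V J f) ->
  (forall l, Normc.normc (fc (X l) - mra_proj Omega V J f (X l)) <= rho) ->
  integrate_converges Omega V J X psi (samples X fc) /\
  Normc.normc (integrate_oo Omega V J X psi (samples X fc) - cint Omega f) <=
    2 * (fine (mra_proj_norm Omega V J) * rho / (1 - eta) * fine (mu Omega)).
Proof.
move=> intf frho; have [cv ->] := integrate_cvg (samples X fc).
split => //; set cs := invmx _ *m _.
pose h x := fc x - mra_proj Omega V J f x.
have -> : cint Omega (lincomb cs) - cint Omega f =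
    cint Omega (lincomb (cs - coefs f)).
  rewrite intf (_ : mra_proj Omega V J f = lincomb (coefs f)).
    by rewrite !cint_lincomb mulmxBr !mxE.
  by apply/funext => x; rewrite mra_projE.
apply: normc_cint_le => //.
  exact/csquare_integrable_cmeasurable/csquare_integrable_lincomb.
(* T applied to g - P_J f leaves P_J Q h: the samples of [fc] minus those of P_J f are the samples
   of h. *)
apply: (lincomb_fixpoint_bound (r := coefs (quasi_interp X psi h))).
  rewrite mulmxBr /cs (mulmxA _ (invmx _)) mulmxV ?mul1mx ?mxMPhi_unit//.
  rewrite coefs_quasi_interp -mulmxA -mulmxBr -samples_lincomb.
  by congr (_ *m _); apply/matrixP => l i; rewrite !mxE /h mra_projE.
move=> x Ox; rewrite -mra_projE; apply: mra_proj_bound => //.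
  apply: csquare_integrable_cmeasurable; apply: csquare_integrable_sum => // l.
  by apply: csquare_integrableZ => //; exact: csquare_integrable_psi.
(* Q h at y is a convex combination of samples of h, hence bounded by rho. *)
move=> y Oy; apply: (le_trans (ler_normc_sum _ _ _)).
rewrite -[rho]mulr1 -(psi1 Oy) mulr_sumr; apply: ler_sum => l _.
have /andP[p0 _] := psi01 l Oy.
by rewrite Normc.normcM normc_real ger0_norm// ler_wpM2r// frho.
Qed.

End iteration.

(** * From L^2 limits to bounds almost everywhere, and from there to bounds everywhere *)

Section almost_everywhere.
Context {R : realType} {d : nat}.
Local Notation E := 'rV[R]_d.
Local Notation C := R[i].
Local Notation mu := (leb R d).
Variable Omega : set E.
Hypothesis mO : measurable Omega.

(* Without this the continuous representative would not be determined by f, for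
   instance at an isolated point of Omega. *)
Definition locally_positive := forall x, Omega x -> forall U, nbhs x U ->
  exists A, [/\ measurable A, A `<=` Omega `&` U & (0 < mu A)%E].

(** If u exceeded K at x, it would do so on a relative neighbourhood of x, hence on a set of
    positive measure inside the null exceptional set. *)
Lemma ae_le_locally_positive (u : E -> R) (K : R) : locally_positive ->
  (forall x, Omega x -> u y @[y --> within Omega (nbhs x)] --> u x) ->
  {ae mu, forall x, Omega x -> u x <= K} ->
  forall x, Omega x -> u x <= K.
Proof.
move=> posO cu [N [mN N0 uN]] x Ox; rewrite leNgt; apply/negP => Kux.
have /(posO x Ox)[A [mA AO A0]] :
    nbhs x [set y | Omega y -> K < u y].
  by have /cvgr_gt/(_ _ Kux) := cu x Ox.
suff : (mu A <= mu N)%E by rewrite N0 leNgt A0.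
apply: le_measure; [exact/mem_set|exact/mem_set|] => y Ay.
have [Oy uy] := AO y Ay; apply: uN => /(_ Oy).
by rewrite leNgt uy.
Qed.

(** The excess of |h| over K is at most |h - H n| at every point of Omega, so its L^2 norm is 0. No
    almost everywhere convergent subsequence has to be extracted. *)
Lemma ae_le_of_Lq_cvg (h : E -> C) (H : nat -> E -> C) (K : R) :
  csquare_integrable Omega h -> (forall n, csquare_integrable Omega (H n)) ->
  (forall n x, Omega x -> Normc.normc (H n x) <= K) ->
  (fun n => Lqnorm Omega 2 (fun x => h x - H n x)) @ \oo --> 0%E ->
  {ae mu, forall x, Omega x -> Normc.normc (h x) <= K}.
Proof.
move=> sh sH HK lim0.
pose w x := Num.max (Normc.normc (h x) - K) 0.
have mw : measurable_fun Omega w.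
  apply: measurable_maxr; last exact: measurable_cst.
  apply: measurable_funB; last exact: measurable_cst.
  by apply: measurable_normc; exact: csquare_integrable_cmeasurable.
have mw2 : measurable_fun Omega (fun x => (w x ^+ 2)%:E).
  by apply/measurable_EFinP; exact: measurable_funX.
have w_ge0 x : 0 <= w x by rewrite le_max lexx orbT.
pose I := (\int[mu]_(x in Omega) (w x ^+ 2)%:E)%E.
have I_ge0 : (0 <= I)%E by apply: integral_ge0 => x _; rewrite lee_fin sqr_ge0.
have Ile n : (I `^ 2^-1 <= Lqnorm Omega 2 (fun x => h x - H n x)%R)%E.
  rewrite Lqnorm2E//; apply: gt0_ler_poweR; first by rewrite invr_ge0.
  - by rewrite in_itv/= I_ge0 leey.
  - rewrite in_itv/= leey andbT; apply: integral_ge0 => x _.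
    by rewrite lee_fin sqr_ge0.
  apply: ge0_le_integral => //.
  - by move=> x _; rewrite lee_fin sqr_ge0.
  - apply/measurable_EFinP; apply: measurable_funX; apply: measurable_normc => //.
    exact/csquare_integrable_cmeasurable/csquare_integrableB.
  - move=> x Ox; rewrite lee_fin ler_sqr ?nnegrE ?normc_ge0//.
    rewrite ge_max normc_ge0 andbT lerBlDr -[in leLHS](subrK (H n x) (h x)).
    by rewrite (le_trans (le_normcD _ _))// lerD2l HK.
have I0 : (\int[mu]_(x in Omega) `|(w x ^+ 2)%:E|)%E = 0%E.
  under eq_integral do rewrite gee0_abs ?lee_fin ?sqr_ge0//.
  apply: (poweR_eq0_eq0 I_ge0 (r := 2^-1)); apply/eqP.
  rewrite eq_le poweR_ge0 andbT; apply: cvge_ge lim0.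
  exact: nearW.
move/(ae_eq_integral_abs _ mO mw2) : I0; apply: filterS => x /= wx Ox.
have /eqP := wx Ox; rewrite eqe expf_eq0/= => /eqP w0.
by rewrite -subr_le0 -w0 le_max lexx.
Qed.

End almost_everywhere.

(** * Consequences of the multiresolution axioms *)

Section multiresolution_facts.
Context {R : realType} {d : nat}.
Local Notation E := 'rV[R]_d.
Local Notation C := R[i].
Local Notation mu := (leb R d).
Variables (Omega : set E) (V : mra_data R d).
Hypothesis mO : measurable Omega.
Hypothesis H1 : MRA1 Omega V.
Hypothesis H2 : MRA2 Omega V.
Hypothesis H3 : MRA3 Omega V.
Local Notation phi := (mra_phi (m := V)).

Lemma mra_phi_space j k : mra_space V j (fun x => (phi (j := j) k x)%:C).
Proof.
have [basis _ _ _ _] := H2; apply/((basis j).1 _).2.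
exists (fun h => (h == k)%:R) => x Ox.
rewrite (bigD1 k)//= eqxx mul1r big1 ?addr0// => h /negPf ->.
by rewrite mul0r.
Qed.

Lemma csquare_integrable_mra_space j f :
  mra_space V j f -> csquare_integrable Omega f.
Proof.
move=> Vf; have [_ _ VL _] := H1; apply: inLq2_csquare_integrable => //.
by apply: VL Vf; rewrite ltr1n.
Qed.

Lemma csquare_integrable_phi j k :
  csquare_integrable Omega (fun x => (phi (j := j) k x)%:C).
Proof. exact: csquare_integrable_mra_space (mra_phi_space k). Qed.

Lemma csquare_integrable_mra_proj j f :
  csquare_integrable Omega (mra_proj Omega V j f).
Proof.
apply: csquare_integrable_sum => // k; apply: csquare_integrableZ => //.
exact: csquare_integrable_phi.
Qed.

Lemma mra_phi_sum j x : Omega x ->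
  \sum_k phi (j := j) k x = 2 `^ (d%:R * j%:R / 2).
Proof.
have [_ _ _ sum1 _] := H2 => /(sum1 j); rewrite powRN => e.
apply: (@mulfI _ (2 `^ (d%:R * j%:R / 2))^-1).
  by rewrite invr_eq0 gt_eqF// powR_gt0.
by rewrite e mulVf// gt_eqF// powR_gt0.
Qed.

Lemma mra_phi_bounded j : exists K : R, forall k x, Omega x ->
  `|phi (j := j) k x| <= K.
Proof.
exists (2 `^ (d%:R * j%:R / 2)) => k x Ox; have [_ phi0 _ _ _] := H2.
rewrite -(mra_phi_sum j Ox) (bigD1 k)//= ger0_norm; last exact: (phi0 j k).2.
by rewrite lerDl; apply: sumr_ge0 => h _; exact: (phi0 j h).2.
Qed.

(* Some phi_(j,k) does not vanish at x; its support is small, and it is not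
   null because its inner product with its dual function is 1. *)
Lemma mra_locally_positive : locally_positive Omega.
Proof.
move=> x Ox U /nbhs_ballP[e /= e0 xeU].
have [_ _ _ _ [c [m [c0 supp_phi]]]] := H2.
(* A level at which every support has diameter below e, found by comparing 2^(k+1) with k+1. *)
have [j je] : exists j : nat, c * 2 `^ (- j%:R) < e.
  have ec0 : 0 < e / c by rewrite divr_gt0.
  have [k _ /(_ k (leqnn k)) /= ke] := near_infty_natSinv_lt (PosNum ec0).
  exists k.+1; rewrite mulrC -ltr_pdivlMr// (le_lt_trans _ ke)//.
  rewrite powRN powR_mulrn// lef_pV2 ?posrE ?exprn_gt0//.
  by rewrite -natrX ler_nat ltnW// ltn_expl.
have [k phikx] : exists k, phi (j := j) k x != 0.
  apply/existsP; rewrite -negb_forall; apply/negP => /forallP phix0.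
  have := mra_phi_sum j Ox; rewrite big1; last by move=> h _; apply/eqP.
  by move=> /esym/eqP; rewrite gt_eqF// powR_gt0.
have sk := csquare_integrable_phi k.
have mk : measurable_fun Omega (phi k).
  by case/csquare_integrable_cmeasurable : sk.
pose A := Omega `&` [set y | phi k y != 0].
have mA : measurable A.
  have -> : A = Omega `&` (phi k) @^-1` (~` [set 0]).
    by apply/seteqP; split => y [Oy /eqP yk].
  by apply: mk => //; apply: measurableC; exact: measurable_set1.
have sA y : A y -> supp Omega (phi k) y by move=> Ay; exact: subset_closure.
exists A; split; [exact: mA|move=> y Ay|].
  split; first by case: Ay.
  (* Supports are measured by the Euclidean norm and balls by the sup-norm; each coordinate is
     bounded by [enorm]. *)
  apply: xeU; split => // a i; rewrite ord1 /ball/= distrC.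
  have [+ _ _] := supp_phi j k => /(_ y x (sA y Ay) (sA x (conj Ox phikx))).
  move=> /le_lt_trans/(_ je); apply: le_lt_trans.
  rewrite /enorm -sqrtr_sqr ler_wsqrtr// (bigD1 i)//= !mxE lerDl.
  by apply: sumr_ge0 => h _; exact: sqr_ge0.
rewrite lt0e measure_ge0 andbT; apply/eqP => A0.
have [sphit biorth _ _ _] := H3.
have := biorth j k k; rewrite eqxx; apply/eqP.
suff -> : inner Omega (fun x0 => (phi k x0)%:C) (mra_dual k) = 0.
  by rewrite eq_sym oner_eq0.
have [iRe iIm] : cintegrable Omega (fun y => (phi k y)%:C * conjc (mra_dual k y)).
  apply: csquare_integrableM => //; apply: csquare_integrableJ => //.
  exact: inLq2_csquare_integrable.
have null (u : E -> R) : mu.-integrable Omega (EFin \o u) ->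
    (forall y, phi k y = 0 -> u y = 0) -> \int[mu]_(y in Omega) u y = 0.
  move=> /integrableP[mu_u _] u0; rewrite /Rintegral.
  rewrite (ae_eq_integral (cst 0%E)) ?integral0//.
  exists A; split => // y /= /not_implyP[Oy uy]; split => //=.
  by apply: contra_not_neq uy => /u0 ->.
by rewrite /inner /cint !null// => y; case: (mra_dual k y) => a b /= ->;
  rewrite ?mul0r ?mulr0 ?subr0 ?addr0 ?oppr0.
Qed.

End multiresolution_facts.

(** * Geometric decay of the wavelet expansion of a Sobolev function *)

Lemma geometric_sum_le (R : realFieldType) (q : R) (m n : nat) :
  0 < q < 1 -> \sum_(m <= j < n) q ^+ j <= q ^+ m / (1 - q).
Proof.
move=> /andP[q0 q1]; have q1' : 0 < 1 - q by rewrite subr_gt0.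
have [mn|/ltnW nm] := leqP m n; last first.
  by rewrite big_geq// divr_ge0 ?exprn_ge0 ?ltW.
rewrite ler_pdivlMr// -(subnKC mn).
suff -> k : (\sum_(m <= j < m + k) q ^+ j) * (1 - q) = q ^+ m - q ^+ (m + k).
  by rewrite gerBl exprn_ge0// ltW.
elim: k => [|k IH]; first by rewrite addn0 big_geq// mul0r subrr.
by rewrite addnS big_nat_recr ?leq_addr//= mulrDl IH exprS; ring.
Qed.

Lemma two_powR_lt1 (R : realType) (r : R) : r < 0 -> 2 `^ r < 1.
Proof.
move=> r0; rewrite -[r]opprK powRN invf_plt ?posrE ?powR_gt0// invr1.
rewrite -[ltLHS](congr1 (@^~ (- r)) (powR1 R)).
by apply: gt0_ltr_powR; rewrite ?oppr_gt0 ?nnegrE ?ltr1n.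
Qed.

Section wavelets.
Context {R : realType} {d : nat}.
Local Notation E := 'rV[R]_d.
Local Notation C := R[i].
Local Notation mu := (leb R d).
Variables (Omega : set E) (V : mra_data R d) (W : wavelet_data R d) (s : R).
Hypothesis mO : measurable Omega.
Hypothesis fO : (mu Omega < +oo)%E.
Hypothesis H1 : MRA1 Omega V.
Hypothesis H2 : MRA2 Omega V.
Hypothesis H3 : MRA3 Omega V.
Hypothesis HW1 : W1 Omega V W.
Hypothesis HW2 : W2 Omega V W s.
Hypothesis HW3 : W3 Omega W.
Hypothesis HW4 : W4 Omega W.
Hypothesis ds : 3 * d%:R / 2 < s.
Local Notation phi := (mra_phi (m := V)).
Local Notation Psi := (wav_psi (w := W)).
Local Notation Psit := (wav_dual (w := W)).
Local Notation q := (2 `^ (3 * d%:R / 2 - s) : R).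

Let q01 : 0 < q < 1.
Proof. by rewrite powR_gt0//= two_powR_lt1// subr_lt0.
Qed.

Lemma sobolev_norm_ge0 f : (0 <= sobolev_norm Omega s f)%E.
Proof. by apply: le_ereal_inf_tmp => _ [F [G [_ _ ->]]]; exact: Lnorm_ge0. Qed.

(* The constants of W2 depend on J; taking them at J = 0 makes the bound uniform
   in the level. *)
Lemma wavelet_coef_le : exists2 c : R, 0 < c &
  forall f, in_sobolev Omega s f -> forall j (k : wav_idx W j),
    2 `^ (s * j%:R) * Normc.normc (inner Omega f (Psit k)) <=
    c * fine (sobolev_norm Omega s f).
Proof.
have [c1 [c [_ c0 equiv]]] := HW2 0; exists c => // f sf j k.
have [_ /(_ sf)[_ +]] := equiv f sf.1.
have Sfin : sobolev_norm Omega s f \is a fin_num.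
  by rewrite ge0_fin_numE ?sobolev_norm_ge0//; case: sf.
rewrite -{1}(fineK Sfin) -EFinM /wavelet_norm; set T := (\sum_(_ <= _ <oo) _)%E.
move=> normle; rewrite -lee_fin (le_trans _ normle)//.
apply: le_trans (leeDr _ (Lnorm_ge0 _ _ _)).
set a := inner _ _ _.
(* The weighted coefficient is the square root of its own term in the series of W2, so monotonicity
   of the root reduces the claim to one term against the series. *)
have -> : 2 `^ (s * j%:R) * Normc.normc a =
    (2 `^ (2 * s * j%:R) * Normc.normc a ^+ 2) `^ 2^-1.
  rewrite powR12_sqrt; last by rewrite mulr_ge0 ?powR_ge0 ?sqr_ge0.
  rewrite -mulrA (mulrC 2) (powRrM _ (s * j%:R)) powR_mulrn ?powR_ge0//.
  rewrite -exprMn sqrtr_sqr.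
  by rewrite ger0_norm// mulr_ge0 ?powR_ge0 ?normc_ge0.
have term_ge0 i : (0 <= (\sum_(h : wav_idx W i) 2 `^ (2 * s * i%:R) *
    Normc.normc (inner Omega f (Psit h)) ^+ 2)%R%:E)%E.
  by rewrite lee_fin; apply: sumr_ge0 => h _; rewrite mulr_ge0 ?powR_ge0 ?sqr_ge0.
have T0 : (0 <= T)%E by apply: nneseries_ge0.
rewrite -poweR_EFin gt0_ler_poweR ?invr_ge0//.
- by rewrite in_itv/= leey andbT lee_fin mulr_ge0 ?powR_ge0 ?sqr_ge0.
- by rewrite in_itv/= leey andbT.
(* The partial sum up to j+1 is the first to contain level j. *)
apply: (le_trans _ (nneseries_lim_ge j.+1 _)) => //.
rewrite big_nat_recr//=; apply: le_trans (leeDr _ _); last exact: sume_ge0.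
rewrite lee_fin (bigD1 k)//= lerDl; apply: sumr_ge0 => h _.
by rewrite mulr_ge0 ?powR_ge0 ?sqr_ge0.
Qed.

(** At level j the exponents add up: d for the number of wavelets, d/2 for their sup-norm and -s for
    their coefficients, which gives 3d/2 - s. Independence of n lets the bound pass to the L^2
    limit. *)
Lemma wavelet_sum_bound : exists2 c : R, 0 < c &
  forall f, in_sobolev Omega s f -> forall (J n : nat) x, Omega x ->
    Normc.normc (\sum_(J <= j < n) \sum_(k : wav_idx W j)
      inner Omega f (Psit k) * Psi k x) <=
    c * fine (sobolev_norm Omega s f) * (q ^+ J / (1 - q)).
Proof.
have [c c0 coefle] := wavelet_coef_le.
have [cPsi [cJ [cPsi0 cJ0 Psile cardle]]] := HW3.
exists (cJ * cPsi * c); first by rewrite !mulr_gt0.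
move=> f sf J n x Ox; set b := fine _.
have b0 : 0 <= b by rewrite fine_ge0// sobolev_norm_ge0.
have level j : Normc.normc (\sum_(k : wav_idx W j)
    inner Omega f (Psit k) * Psi k x) <= cJ * cPsi * c * b * q ^+ j.
  apply: (le_trans (ler_normc_sum _ _ _)).
  pose B := (2 `^ (s * j%:R))^-1 * (c * b) * (cPsi * 2 `^ (d%:R * j%:R / 2)).
  have [cW cPsiW] := (ltW c0, ltW cPsi0).
  have B0 : 0 <= B by rewrite !mulr_ge0 ?invr_ge0 ?powR_ge0.
  have /le_trans : \sum_(k : wav_idx W j) Normc.normc (inner Omega f (Psit k) * Psi k x)
      <= \sum_(k : wav_idx W j) B; last apply.
    apply: ler_sum => k _; rewrite Normc.normcM ler_pM ?normc_ge0//.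
      by rewrite mulrC ler_pdivlMr ?powR_gt0// mulrC coefle.
    by move/supnorm_leP : (Psile j k); exact.
  rewrite sumr_const -[leLHS]mulr_natl.
  apply: (le_trans (ler_wpM2r B0 (cardle j))); rewrite le_eqVlt; apply/orP; left.
  apply/eqP; rewrite /B -powR_mulrn ?powR_ge0// -powRrM.
  have -> : (3 * d%:R / 2 - s) * j%:R =
      d%:R * j%:R + d%:R * j%:R / 2 + - (s * j%:R) :> R by field.
  rewrite !powRD ?pnatr_eq0 ?implybT// powRN; ring.
apply: (le_trans (ler_normc_sum _ _ _)).
apply: (le_trans (ler_sum _ (fun j _ => level j))).
rewrite -mulr_sumr ler_wpM2l ?geometric_sum_le//.
by rewrite !mulr_ge0// ltW.
Qed.

Let wsum f J n x : C := \sum_(J <= j < n) \sum_(k : wav_idx W j)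
  inner Omega f (Psit k) * Psi k x.

Let csquare_integrable_Psi j (k : wav_idx W j) :
  csquare_integrable Omega (Psi k).
Proof.
have [PsiV _ _ _] := HW1.
by apply: (csquare_integrable_mra_space mO H1); exact: (PsiV _ _).1.
Qed.

Let csquare_integrable_wsum f J n : csquare_integrable Omega (wsum f J n).
Proof.
do 2 (apply: csquare_integrable_sum => // ?).
by apply: csquare_integrableZ => //; exact: csquare_integrable_Psi.
Qed.

Lemma cint_mra_proj J f : inLq Omega 2 f ->
  cint Omega f = cint Omega (mra_proj Omega V J f).
Proof.
move=> Lf; have sf := inLq2_csquare_integrable mO Lf.
have sPf := csquare_integrable_mra_proj mO H1 H2 J f.
have [_ _ _ /(_ J f Lf)] := HW1; apply: cint_Lq_cvg => // n.
  exact: (csquare_integrableD mO sPf (csquare_integrable_wsum f J n)).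
rewrite (cintD mO (csquare_integrable_cintegrable mO fO sPf)
  (csquare_integrable_cintegrable mO fO (csquare_integrable_wsum f J n))).
rewrite [X in _ + X](_ : _ = 0) ?addr0// /wsum.
have iPsi j (k : wav_idx W j) :
    cintegrable Omega (fun x => inner Omega f (Psit k) * Psi k x).
  by apply: cintegrableZ => //; exact: csquare_integrable_cintegrable.
rewrite cint_sum//; last by move=> j; exact: cintegrable_sum.
rewrite big1// => j _; rewrite cint_sum// big1// => k _.
by rewrite cintZ ?HW4 ?mulr0//; exact: csquare_integrable_cintegrable.
Qed.

Lemma continuous_mra_proj J f x : Omega x ->
  complex.Re (mra_proj Omega V J f y) @[y --> within Omega (nbhs x)] -->
    complex.Re (mra_proj Omega V J f x) /\
  complex.Im (mra_proj Omega V J f y) @[y --> within Omega (nbhs x)] -->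
    complex.Im (mra_proj Omega V J f x).
Proof.
move=> Ox; have [_ C1phi _ _ _] := H2.
have cphi k : phi (j := J) k y @[y --> within Omega (nbhs x)] --> phi k x.
  apply: cvg_within_filter; have [[U [_ OU dphi _]] _] := C1phi J k.
  exact: differentiable_continuous (dphi x (OU x Ox)).
have csum (a : 'I_(mra_N V J).+1 -> R) :
    \sum_k a k * phi k y @[y --> within Omega (nbhs x)] --> \sum_k a k * phi k x.
  apply: cvg_big => [|k _]; first exact: add_continuous.
  by apply: cvgM => //; exact: cvg_cst.
have ReE y : complex.Re (mra_proj Omega V J f y) =
    \sum_(k < (mra_N V J).+1) complex.Re (inner Omega f (mra_dual k)) * phi k y.
  by rewrite cRe_sum; apply: eq_bigr => k _; rewrite cReM /= mulr0 subr0.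
have ImE y : complex.Im (mra_proj Omega V J f y) =
    \sum_(k < (mra_N V J).+1) complex.Im (inner Omega f (mra_dual k)) * phi k y.
  by rewrite cIm_sum; apply: eq_bigr => k _; rewrite cImM /= mulr0 add0r.
by split; [rewrite ReE; under eq_fun do rewrite ReE|
           rewrite ImE; under eq_fun do rewrite ImE]; exact: csum.
Qed.

(* The bound holds almost everywhere by L^2-convergence of the wavelet
   expansion, hence everywhere by continuity. *)
Lemma mra_proj_error_bound : exists2 c : R, 0 < c &
  forall f fc, in_sobolev Omega s f -> continuous_representative Omega f fc ->
  forall J x, Omega x ->
    Normc.normc (fc x - mra_proj Omega V J f x) <=
    c * fine (sobolev_norm Omega s f) * (q ^+ J / (1 - q)).
Proof.
have [c c0 wbound] := wavelet_sum_bound.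
exists c => // f fc sobf [[cRe cIm] fcf] J.
have sf := inLq2_csquare_integrable mO sobf.1.
have sPf := csquare_integrable_mra_proj mO H1 H2 J f.
set K := c * _ * _.
have aebound : {ae mu, forall x, Omega x ->
    Normc.normc (f x - mra_proj Omega V J f x) <= K}.
  apply: (ae_le_of_Lq_cvg mO (H := wsum f J)) => //.
  - exact: csquare_integrableB.
  - by move=> n x Ox; exact: wbound.
  have [_ _ _ /(_ J f sobf.1)] := HW1; apply: cvg_trans.
  apply: near_eq_cvg; apply: nearW => n; congr Lqnorm.
  by apply/funext => x; rewrite opprD addrA.
have K0 : 0 <= K.
  have /andP[q0 q1] := q01.
  rewrite mulr_ge0 ?divr_ge0 ?exprn_ge0 ?subr_ge0 ?(ltW q1) ?(ltW q0)//.
  by rewrite mulr_ge0 ?(ltW c0)// fine_ge0// sobolev_norm_ge0.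
(* Squaring makes the compared function a polynomial in real and imaginary parts, so its continuity
   follows from that of the parts. *)
move=> x Ox; rewrite -ler_sqr ?nnegrE ?normc_ge0//.
apply: (ae_le_locally_positive (u := fun y =>
  Normc.normc (fc y - mra_proj Omega V J f y) ^+ 2) _ _ _ Ox).
- exact: mra_locally_positive mO H1 H2 H3.
- move=> y Oy; have [PRe PIm] := continuous_mra_proj J f Oy.
  have Fre := cvgB ((subspace_continuousP _ _).1 cRe y Oy) PRe.
  have Fim := cvgB ((subspace_continuousP _ _).1 cIm y Oy) PIm.
  rewrite normc_sqr cReB cImB.
  under eq_fun do rewrite normc_sqr cReB cImB !expr2.
  rewrite !expr2.
  by apply: cvgD; apply: cvgM; [exact: Fre|exact: Fre|exact: Fim|exact: Fim].
- apply: filterS2 aebound fcf => y bnd eqf Oy.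
  by rewrite eqf// ler_sqr ?nnegrE ?normc_ge0// bnd.
Qed.

End wavelets.

Theorem proposition5p3 (R : realType) (d : nat) (Omega : set 'rV[R]_d)
    (V : mra_data R d) (W : wavelet_data R d) (s : R) :
  (0 < d)%N -> compact Omega ->
  MRA1 Omega V -> MRA2 Omega V -> MRA3 Omega V ->
  W1 Omega V W -> W2 Omega V W s -> W3 Omega W -> W4 Omega W ->
  3 * d%:R / 2 < s ->
  exists2 C : R, 0 < C &
    forall (J M : nat) (Delta eta : R)
      (X : 'I_M.+1 -> 'rV[R]_d) (psi : 'I_M.+1 -> 'rV[R]_d -> R),
    dense_sample Omega Delta X -> sample_partition Omega Delta X psi ->
    0 < eta < 1 ->
    (forall g, mra_space V J g ->
       (supnorm Omega
          (fun x => g x - mra_proj Omega V J (quasi_interp X psi g) x)%R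
        <= eta%:E * supnorm Omega g)%E) ->
    forall f fc : 'rV[R]_d -> R[i],
    in_sobolev Omega s f -> continuous_representative Omega f fc ->
    integrate_converges Omega V J X psi (samples X fc) /\
    Normc.normc
      (integrate_oo Omega V J X psi (samples X fc) - cint Omega f) <=
    C * (fine (leb R d Omega) * fine (mra_proj_norm Omega V J) / (1 - eta)) *
    fine (sobolev_norm Omega s f) *
    (2 `^ ((3 * d%:R / 2 - s) * J.+1%:R) / (1 - 2 `^ (3 * d%:R / 2 - s))).
Proof.
move=> _ cO H1 H2 H3 HW1 HW2 HW3 HW4 ds.
have mO := compact_rV_measurable cO; have fO := compact_leb_lty cO.
have [c c0 errbound] := mra_proj_error_bound mO H1 H2 H3 HW1 HW2 HW3 ds.
pose q : R := 2 `^ (3 * d%:R / 2 - s).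
have q0 : 0 < q by rewrite powR_gt0.
(* The 2 comes from estimating real and imaginary parts of an integral separately, c from the
   projection error, and 1/q from passing from q^J to the q^(J+1) of the claim. *)
exists (2 * c / q); first by rewrite divr_gt0// mulr_gt0.
move=> J M Delta eta X psi [_ XO _] [mpsi psi01 _ psi1] eta01 contraction.
move=> f fc sobf repf.
have [sphit _ _ P_fin _] := H3; have [basis _ _ _ _] := H2.
have intf := cint_mra_proj mO fO H1 H2 HW1 HW4 J sobf.1.
have [cvg err] := integrate_error mO fO (basis J)
  (fun k => csquare_integrable_phi mO H1 H2 k)
  (fun k => inLq2_csquare_integrable mO (sphit J k))
  (mra_phi_bounded H2 J) XO mpsi psi01 psi1 eta01 contraction (P_fin J) intf
  (fun l => errbound f fc sobf repf J (X l) (XO l)).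
split => //; apply: (le_trans err).
rewrite -/q le_eqVlt; apply/orP; left; apply/eqP.
have -> : 2 `^ ((3 * d%:R / 2 - s) * J.+1%:R) = q ^+ J.+1.
  by rewrite powRrM powR_mulrn// powR_ge0.
have eta0 : 1 - eta != 0 by rewrite gt_eqF// subr_gt0; case/andP : eta01.
have q1 : 1 - q != 0.
  by rewrite gt_eqF// subr_gt0 two_powR_lt1// subr_lt0.
rewrite exprS; field; rewrite q1 eta0 gt_eqF//.
Qed.
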